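(* Let $(V,q)$ be a finite dimensional graded associative algebra (with $q$ of degree $0$) over a field of characteristic $0$, let $M$ be a finite dimensional graded $(V,q)$-bimodule, and let $(\tilde V,\tilde b,\tilde q)$ be the double semi-direct product of $V$ by $M$, with associated symplectic form $\tilde B$ on $\tilde V[1]$ and associated Pinczon bracket $\{\ ,\ \}\tilde{\ }$ on $\mathcal C(\tilde V)$. Let $\Phi:c\mapsto\tilde C$ be the map associating to any $k$-linear mapping $c$ from $V^k$ into $M$, with degree $2-k$, the $\tilde B$-quadratic map $\tilde C$. Then $\Phi$ is a morphism from the Hochschild cohomology complex for the $(V,q)$-bimodule $M$ to the Pinczon cohomology complex of cyclic forms $\mathcal C(\tilde V)$ on $\tilde V$; that is, for every such $c$, $d_P\tilde C=\widetilde{d_Hc[1]}$, i.e. $$\{\Omega_{\tilde Q},\Omega_{\tilde C}\}\tilde{\ }=\Omega_{\widetilde{d_Hc[1]}},$$ where $d_H$ is the Hochschild coboundary operator.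
   Context: Grading and signs. For a graded space $U$, $|x|$ is the degree in $U$, and $U[1]$ is the same space with degree $\deg(x)=|x|-1$. Koszul's sign rule is used everywhere: each term in which graded letters appear in an order differing from that of the first term by a permutation carries the implicit sign of that permutation computed only on letters of odd degree (the degree $|\cdot|$ for formulas on $V,M,\tilde V$; the degree $\deg$ for formulas on shifted spaces). To a $k$-linear map $q$ on $U$ one associates the map on $U[1]$ (denoted by the capital letter, or by $[1]$) $Q(x_1,\ldots,x_k)=(-1)^{\sum_{j\le k}(k-j)\deg(x_j)}q(x_1,\ldots,x_k)$, of degree $|q|+k-1$. Double semi-direct product. Write $q(x,y)=xy$. $W=V\times M$ with product $q_W((x,a),(y,b))=(xy,x\cdot b+a\cdot y)$; its dual $W^\star=V^\star\times M^\star$ is a $W$-bimodule by $(w\cdot f)(z)=f(zw)$, $(f\cdot w)(z)=f(wz)$. $\tilde V=W\times W^\star=\{(x,a,g,h):x\in V,a\in M,g\in V^\star,h\in M^\star\}$, with product $\tilde q((w,f),(w',f'))=(q_W(w,w'),w\cdot f'+f\cdot w')$ and symmetric bilinear form $\tilde b((x,a,g,h),(x',a',g',h'))=g(x')+h(a')+g'(x)+h'(a)$. $(\tilde V,\tilde b,\tilde q)$ is a quadratic associative algebra. $\tilde B(u,v)=(-1)^{\deg(u)}\tilde b(u,v)$ on $\tilde V[1]$, and $\tilde Q(u,v)=(-1)^{\deg(u)}\tilde q(u,v)$. Cyclic forms and Pinczon bracket. An $n$-linear form on $\tilde V[1]$ is cyclic if it is invariant (with Koszul signs) under cyclic permutations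 of its arguments; $\mathcal C(\tilde V)$ is the space of cyclic forms; $\Omega^{Cycl}$ is the sum of the images of $\Omega$ under the cyclic group generated by $(1,\ldots,n)$. For a $k$-linear $R:\tilde V[1]^k\to\tilde V[1]$, $\Omega_R(u_1,\ldots,u_{k+1})=\tilde B(R(u_1,\ldots,u_k),u_{k+1})$; $R$ is $\tilde B$-quadratic if $\Omega_R$ is cyclic. The Pinczon bracket is $\{\Omega,\Omega'\}\tilde{\ }=\sum_i(\iota_{e_i}\Omega\otimes\iota_{e'_i}\Omega')^{Cycl}$, with $(e_i)$ a basis of $\tilde V$, $\tilde b(e_i,e'_j)=\delta_{ij}$, $\iota$ insertion of a vector, signs normalized so that $\sum_i\iota_{e_i}\Omega_R\otimes\iota_{e'_i}\Omega_{R'}$ is $(u_1,\ldots,u_{k+k'})\mapsto\tilde B(R(u_1,\ldots,u_k),R'(u_{k+1},\ldots,u_{k+k'}))$. The Pinczon complex is $\mathcal C(\tilde V)$ with differential $\Lambda\mapsto\{\Omega_{\tilde Q},\Lambda\}\tilde{\ }$; $d_P$ is defined on $\tilde B$-quadratic maps $R$ by $\{\Omega_{\tilde Q},\Omega_R\}\tilde{\ }=\Omega_{d_PR}$. The map $\Phi$. For a $k$-linear $c:V^k\to M$ with shifted map $C$ (of degree $1$ if $|c|=2-k$), let $C'((x_1,a_1,g_1,h_1),\ldots,(x_k,a_k,g_k,h_k))=(0,C(x_1,\ldots,x_k),0,0)$, and let $\tilde C$ be the $\tilde B$-quadratic map defined by $\Omega_{\tilde C}=(\Omega_{C'})^{Cycl}$.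 The same formula defines $\tilde D$ for any multilinear $D:V[1]^n\to M[1]$. Hochschild coboundary. In shifted form, with $Q(x,y)=(-1)^{\deg x}xy$, $Q(x,a)=(-1)^{\deg x}x\cdot a$, $Q(a,x)=(-1)^{\deg a}a\cdot x$ for $x,y\in V[1]$, $a\in M[1]$, and $C$ of degree $1$: $d_Hc[1](x_1,\ldots,x_{k+1})=[Q,C](x_1,\ldots,x_{k+1})=(-1)^{\deg x_1}Q(x_1,C(x_2,\ldots,x_{k+1}))+Q(C(x_1,\ldots,x_k),x_{k+1})+\sum_{r=1}^k(-1)^{\deg x_1+\cdots+\deg x_{r-1}}C(x_1,\ldots,Q(x_r,x_{r+1}),\ldots,x_{k+1})$.
   Formalization: The Pinczon bracket is taken with the Koszul sign of R' passing u_1,…,u_k, i.e. the contraction is (-1)^{deg R'(deg u_1+…+deg u_k)} B̃(R(u_1,…,u_k),R'(u_{k+1},…)); without this sign the identity fails when V and M have mixed parities. *)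

(* Defs.v *)
From HB Require Import structures.
From mathcomp Require Import all_boot all_order all_algebra all_fingroup zify.

Set Implicit Arguments.
Unset Strict Implicit.
Unset Printing Implicit Defensive.

Import GRing.Theory.
Local Open Scope ring_scope.

(* A Z-grading, given by the projections x |-> x_n onto the homogeneous
   components; gdegs lists finitely many degrees outside of which x_n = 0. *)
Record grading (K : fieldType) (U : vectType K) := Grading {
  gpart : int -> U -> U;
  gpart_linear : forall n, linear (gpart n);
  gpartK : forall m n x, gpart m (gpart n x) = if m == n then gpart n x else 0;
  gdegs : seq int;
  gdegs_uniq : uniq gdegs;
  gpart_sum : forall x, \sum_(n <- gdegs) gpart n x = x
}.

HB.instance Definition _ (K : fieldType) (U : vectType K) (g : grading U) n :=
  GRing.isLinear.Build K U U *:%R (gpart g n) (gpart_linear g n).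

Section Gradings.

Variables (K : fieldType) (U : vectType K) (g : grading U).

Definition homog (n : int) (x : U) : Prop := gpart g n x = x.

(* The sum of the components of even (b = false) or odd (b = true) degree. *)
Definition par (b : bool) (x : U) : U :=
  \sum_(n <- gdegs g | odd `|n|%N == b) gpart g n x.

(* The linear map x |-> (-1)^(degree of x) x. *)
Definition sgn (x : U) : U := par false x - par true x.

(* The linear extension of an expression F in n homogeneous vectors that
   depends on the parities p of their degrees. *)
Definition by_parity (n : nat) (Y : zmodType)
    (F : {ffun 'I_n -> bool} -> (U ^ n)%type -> Y) (u : (U ^ n)%type) : Y :=
  \sum_(p : {ffun 'I_n -> bool}) F p [ffun i => par (p i) (u i)].

Lemma gpart_notin n x : n \notin gdegs g -> gpart g n x = 0.
Proof.
move=> nP; rewrite -{1}(gpart_sum g x) linear_sum big_seq big1 //= => m mP.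
by rewrite gpartK; case: eqP => // nm; rewrite nm mP in nP.
Qed.

Lemma gpart_sum_sub (s : seq int) x :
  uniq s -> {subset gdegs g <= s} -> \sum_(n <- s) gpart g n x = x.
Proof.
move=> us ss; rewrite -[RHS](gpart_sum g x).
rewrite (bigID [in gdegs g]) /= [X in _ + X]big1 ?addr0; last first.
  by move=> n /gpart_notin ->.
rewrite -big_filter; apply: perm_big; apply: uniq_perm.
- exact: filter_uniq.
- exact: gdegs_uniq.
by move=> n; rewrite mem_filter andb_idr // => /ss.
Qed.

Fact gshift_linear n : linear (gpart g (n + 1)).
Proof. exact: gpart_linear. Qed.

Fact gshiftK m n x : gpart g (m + 1) (gpart g (n + 1) x) =
  if m == n then gpart g (n + 1) x else 0.
Proof. by rewrite gpartK (inj_eq (addIr 1)). Qed.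

Fact gshift_uniq : uniq [seq n - 1 | n <- gdegs g].
Proof. by rewrite map_inj_uniq ?gdegs_uniq //; apply: addIr. Qed.

Fact gshift_sum x :
  \sum_(n <- [seq n - 1 | n <- gdegs g]) gpart g (n + 1) x = x.
Proof.
rewrite big_map -[RHS](gpart_sum g x).
by apply: eq_bigr => n _; rewrite subrK.
Qed.

(* U[1]: an element of degree n in U[1] has degree n + 1 in U. *)
Definition gshift : grading U :=
  Grading gshift_linear gshiftK gshift_uniq gshift_sum.

Definition gdual_part (n : int) (f : 'Hom(U, K^o)) : 'Hom(U, K^o) :=
  linfun (f \o gpart g (- n)).

Fact gdual_linear n : linear (gdual_part n).
Proof.
by move=> a f h; apply/lfunP => x; rewrite !lfunE /= !lfunE /= !lfunE.
Qed.

Fact gdualK m n f :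
  gdual_part m (gdual_part n f) = if m == n then gdual_part n f else 0.
Proof.
apply/lfunP => y; rewrite !lfunE /= lfunE /= gpartK eqr_opp eq_sym.
by case: eqP => [->|_]; rewrite lfunE ?linear0.
Qed.

Fact gdual_uniq : uniq [seq - n | n <- gdegs g].
Proof. by rewrite map_inj_uniq ?gdegs_uniq //; apply: oppr_inj. Qed.

Fact gdual_sum f : \sum_(n <- [seq - n | n <- gdegs g]) gdual_part n f = f.
Proof.
apply/lfunP => y; rewrite sum_lfunE big_map.
under eq_bigr do rewrite lfunE /= opprK.
by rewrite -linear_sum gpart_sum.
Qed.

(* U*: a form of degree n is supported in degree - n. *)
Definition gdual : grading 'Hom(U, K^o) :=
  Grading gdual_linear gdualK gdual_uniq gdual_sum.

End Gradings.

Section ProductGrading.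

Variables (K : fieldType) (U U' : vectType K) (g : grading U) (g' : grading U').

Definition gprod_part (n : int) (u : U * U') : U * U' :=
  (gpart g n u.1, gpart g' n u.2).

Fact gprod_linear n : linear (gprod_part n).
Proof. by move=> a u v; rewrite /gprod_part !linearP. Qed.

Fact gprodK m n u :
  gprod_part m (gprod_part n u) = if m == n then gprod_part n u else 0.
Proof. by rewrite /gprod_part !gpartK; case: eqP. Qed.

Fact gprod_sum u :
  \sum_(n <- undup (gdegs g ++ gdegs g')) gprod_part n u = u.
Proof.
rewrite [LHS]surjective_pairing [RHS]surjective_pairing.
rewrite (raddf_sum (@fst U U')) (raddf_sum (@snd U U')) /=.
congr pair; apply: gpart_sum_sub (undup_uniq _) _ => n nP.
  by rewrite mem_undup mem_cat nP.
by rewrite mem_undup mem_cat nP orbT.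
Qed.

Definition gprod : grading (U * U')%type :=
  Grading gprod_linear gprodK (undup_uniq _) gprod_sum.

End ProductGrading.

Section ParityTheory.
Variables (K : fieldType) (U : vectType K) (g : grading U).

Lemma par_is_linear b : linear (par g b).
Proof.
move=> a x y; rewrite /par scaler_sumr -big_split /=.
by apply: eq_bigr => n _; rewrite linearP.
Qed.

HB.instance Definition _ b :=
  GRing.isLinear.Build K U U *:%R (par g b) (par_is_linear b).

Lemma par_sub (s : seq int) b x : uniq s -> {subset gdegs g <= s} ->
  par g b x = \sum_(n <- s | odd `|n|%N == b) gpart g n x.
Proof.
move=> us ss; rewrite /par [RHS](bigID [in gdegs g]) /= [X in _ + X]big1 ?addr0.
  rewrite -big_filter -[RHS]big_filter; apply: perm_big; apply: uniq_perm.
  - exact: filter_uniq (gdegs_uniq g).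
  - exact: filter_uniq.
  move=> n; rewrite !mem_filter -andbA; case: (_ == b) => //=.
  by rewrite andb_idr // => /ss.
by move=> n /andP[_ /gpart_notin ->].
Qed.

Lemma gpart_par n b x :
  gpart g n (par g b x) = if odd `|n|%N == b then gpart g n x else 0.
Proof.
rewrite /par linear_sum /=; under eq_bigr do rewrite gpartK.
case: (boolP (n \in gdegs g)) => [nP|nP].
  case: (boolP (odd `|n|%N == b)) => nb.
    rewrite -big_filter (bigD1_seq n) ?mem_filter ?nb ?filter_uniq ?gdegs_uniq //=.
    by rewrite eqxx big1 ?addr0 // => i; rewrite eq_sym => /negPf->.
  rewrite big1 // => i ib; case: (n =P i) => // ni.
  by rewrite ni ib in nb.
rewrite (gpart_notin x nP) if_same big_seq_cond big1 // => i /andP[iP _].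
by case: eqP => // ni; rewrite ni iP in nP.
Qed.

Lemma parK b b' x : par g b (par g b' x) = if b == b' then par g b x else 0.
Proof.
rewrite {1}/par; under eq_bigr do rewrite gpart_par.
case: eqP => [<-|bb'].
  by rewrite /par; apply: eq_bigr => n ->.
by apply: big1 => n /eqP ->; case: eqP.
Qed.

Lemma par_sum x : par g false x + par g true x = x.
Proof.
rewrite -[RHS](gpart_sum g x) (bigID (fun n : int => odd `|n|%N == false)) /=.
by congr +%R; apply: eq_bigl => n; case: odd.
Qed.

Lemma sgn_is_linear : linear (sgn g).
Proof. by move=> a x y; rewrite /sgn !par_is_linear scalerBr opprD addrACA. Qed.

HB.instance Definition _ :=
  GRing.isLinear.Build K U U *:%R (sgn g) sgn_is_linear.

Lemma sgn_par b x : sgn g (par g b x) = (-1) ^+ b *: par g b x.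
Proof.
rewrite /sgn !parK; case: b => /=; rewrite ?subr0 ?sub0r ?expr1 ?scaleN1r //.
by rewrite expr0 scale1r.
Qed.

Lemma par_sgn b x : par g b (sgn g x) = (-1) ^+ b *: par g b x.
Proof.
rewrite /sgn linearB /= !parK; case: b => /=.
  by rewrite sub0r expr1 scaleN1r.
by rewrite subr0 expr0 scale1r.
Qed.

Lemma sgnK : involutive (sgn g).
Proof.
move=> x; rewrite {1}/sgn !par_sgn expr0 expr1 scale1r scaleN1r opprK.
exact: par_sum.
Qed.

Lemma par_gshift b x : par (gshift g) b x = par g (~~ b) x.
Proof.
rewrite /par big_map; apply: eq_big => [n|n _] /=; last by rewrite subrK.
have -> : odd `|n - 1|%N = ~~ odd `|n|%N by lia.
by case: odd; case: b.
Qed.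

Lemma par_gdual b (f : 'Hom(U, K^o)) x : par (gdual g) b f x = f (par g b x).
Proof.
rewrite /par sum_lfunE big_map linear_sum /=.
by apply: eq_big => [n|n _]; rewrite ?abszN // lfunE /= opprK.
Qed.

End ParityTheory.

Lemma par_gprod (K : fieldType) (U U' : vectType K) (g : grading U)
  (g' : grading U') b u : par (gprod g g') b u = (par g b u.1, par g' b u.2).
Proof.
rewrite [LHS]surjective_pairing {1 2}/par.
rewrite (raddf_sum (@fst U U')) (raddf_sum (@snd U U')) /=.
congr pair; symmetry; apply: par_sub (undup_uniq _) _ => n nP.
  by rewrite mem_undup mem_cat nP.
by rewrite mem_undup mem_cat nP orbT.
Qed.

Section MultilinearMaps.

Variables (K : fieldType) (U : vectType K).

Definition multilinear (n : nat) (Y : lmodType K) (f : (U ^ n)%type -> Y) :=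
  forall (u : (U ^ n)%type) (i : 'I_n),
    linear (fun x : U => f [ffun j => if j == i then x else u j]).

Definition ff_init (n : nat) (T : Type) (u : (T ^ n.+1)%type) : (T ^ n)%type :=
  [ffun i => u (lift ord_max i)].

Definition ff_tail (n : nat) (T : Type) (u : (T ^ n.+1)%type) : (T ^ n)%type :=
  [ffun i => u (lift ord0 i)].

Definition ff_snoc (n : nat) (T : Type) (u : (T ^ n)%type) (x : T) :
    (T ^ n.+1)%type :=
  [ffun i => if unlift ord_max i is Some j then u j else x].

(* The arguments (x_0, .., m x_r x_(r+1), .., x_n). *)
Definition ff_merge (n : nat) (T : Type) (m : T -> T -> T) (r : 'I_n)
    (x : (T ^ n.+1)%type) : (T ^ n)%type :=
  [ffun i : 'I_n => if (i < r)%N then x (lift ord_max i)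
                    else if i == r then m (x (lift ord_max r)) (x (lift ord0 r))
                    else x (lift ord0 i)].

Variable g : grading U.

(* The map Q of arity k on U[1] attached to q, where g is the grading of U[1]. *)
Definition shiftmap (k : nat) (Y : lmodType K) (q : (U ^ k)%type -> Y) :
    (U ^ k)%type -> Y :=
  by_parity g (fun p x =>
    (-1) ^+ (\sum_(j < k) (k - j.+1) * p j)%N *: q x).

(* The same map for k = 2, allowing arguments in two different spaces. *)
Definition shift2 (U' Y : vectType K) (q : U -> U' -> Y) (x : U) (y : U') : Y :=
  q (sgn g x) y.

(* The parity of the number of inversions of s between odd letters, i.e. the
   sign of the permutation s restricted to these. *)
Definition koszul (n : nat) (s : 'S_n) (p : {ffun 'I_n -> bool}) : bool :=
  \big[addb/false]_(i < n) \big[addb/false]_(j < n | (i < j)%N && (s j < s i)%N)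
    (p (s i) && p (s j)).

(* The image of a form under a permutation, with Koszul sign. *)
Definition perm_form (n : nat) (s : 'S_n) (Om : (U ^ n)%type -> K^o) :
    (U ^ n)%type -> K^o :=
  by_parity g (fun p u => (-1) ^+ koszul s p * Om [ffun i => u (s i)]).

Definition cycle_perm (n : nat) : 'S_n := perm (@ordS_inj n).

Definition cyclic_form (n : nat) (Om : (U ^ n)%type -> K^o) : Prop :=
  multilinear Om /\
  forall s, s \in <[cycle_perm n]>%g -> perm_form s Om =1 Om.

Definition cycl (n : nat) (Om : (U ^ n)%type -> K^o) : (U ^ n)%type -> K^o :=
  fun u => \sum_(s in <[cycle_perm n]>%g) perm_form s Om u.

End MultilinearMaps.

Section Bimodules.

Variable K : fieldType.

Definition degree0 (A B Y : vectType K) (gA : grading A) (gB : grading B)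
    (gY : grading Y) (f : A -> B -> Y) : Prop :=
  forall m n x y, homog gA m x -> homog gB n y -> homog gY (m + n) (f x y).

Definition graded_algebra (V : vectType K) (gV : grading V)
    (q : {bilinear V -> V -> V}) : Prop :=
  associative q /\ degree0 gV gV gV q.

Definition graded_bimodule (V M : vectType K) (gV : grading V) (gM : grading M)
    (q : {bilinear V -> V -> V}) (l : {bilinear V -> M -> M})
    (r : {bilinear M -> V -> M}) : Prop :=
  [/\ degree0 gV gM gM l, degree0 gM gV gM r,
      forall x y a, l (q x y) a = l x (l y a),
      forall a x y, r a (q x y) = r (r a x) y &
      forall x a y, r (l x a) y = l x (r a y)].

End Bimodules.

Section DoubleSemiDirectProduct.

Variables (K : fieldType) (V M : vectType K) (gV : grading V) (gM : grading M).
Variables (q : {bilinear V -> V -> V}) (l : {bilinear V -> M -> M})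
          (r : {bilinear M -> V -> M}).

Definition W : vectType K := (V * M)%type.
Definition Wd : vectType K := ('Hom(V, K^o) * 'Hom(M, K^o))%type.
Definition Vt : vectType K := (W * Wd)%type.

Definition gW : grading W := gprod gV gM.
Definition gWd : grading Wd := gprod (gdual gV) (gdual gM).
Definition gVt : grading Vt := gprod gW gWd.

Definition qW (w w' : W) : W := (q w.1 w'.1, l w.1 w'.2 + r w.2 w'.1).

(* W* = V* x M* as the space of linear forms on W. *)
Definition ev (f : Wd) (w : W) : K := f.1 w.1 + f.2 w.2.
Definition form_of (phi : W -> K^o) : Wd :=
  (linfun (fun x => phi (x, 0)), linfun (fun a => phi (0, a))).

(* (w.f)(z) = f(zw), with the Koszul sign of w moving past f and z. *)
Definition lactd (w : W) (f : Wd) : Wd :=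
  form_of (fun z => \sum_(p : bool) \sum_(s : bool) \sum_(t : bool)
    (-1) ^+ (p && (s (+) t)) *
      ev (par gWd s f) (qW (par gW t z) (par gW p w))).

Definition ractd (f : Wd) (w : W) : Wd := form_of (fun z => ev f (qW w z)).

Definition qt (u v : Vt) : Vt := (qW u.1 v.1, lactd u.1 v.2 + ractd u.2 v.1).

(* With the Koszul sign of the form v.2 moving past the vector u.1. *)
Definition bt (u v : Vt) : K :=
  ev u.2 v.1 +
  \sum_(s : bool) \sum_(p : bool)
    (-1) ^+ (s && p) * ev (par gWd s v.2) (par gW p u.1).

Definition gV1 : grading V := gshift gV.
Definition gM1 : grading M := gshift gM.
Definition gVt1 : grading Vt := gshift gVt.

Definition Bt (u v : Vt) : K := bt (sgn gVt1 u) v.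
Definition Qt (u : (Vt ^ 2)%type) : Vt := shift2 gVt1 qt (u ord0) (u ord_max).

Definition Omega (k : nat) (R : (Vt ^ k)%type -> Vt) : (Vt ^ k.+1)%type -> K^o :=
  fun u => Bt (R (ff_init u)) (u ord_max).

Definition quadratic (k : nat) (R : (Vt ^ k)%type -> Vt) : Prop :=
  multilinear R /\ cyclic_form gVt1 (Omega R).

(* The map R such that Omega R = Om: since Bt is nondegenerate, R(u) is the
   preimage of the linear form Om(u, _) under v |-> Bt(v, _). *)
Definition map_of_form (k : nat) (Om : (Vt ^ k.+1)%type -> K^o)
    (u : (Vt ^ k)%type) : Vt :=
  ((linfun (fun v : Vt => linfun (Bt v : Vt -> K^o)))^-1)%VF
    (linfun (fun v : Vt => Om (ff_snoc u v))).

(* The form sum_i (iota_(e_i) Om (x) iota_(e'_i) Om') of the Pinczon bracket,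
   with vectors inserted in the last slot. The sign is the product of
   (-1)^(deg e_i) and of the Koszul sign of Om' moving past u_1, .., u_k, where
   Om' has the parity of its list of arguments u_(k+1), .., u_(k+k'), e'_i.
   For Om = Omega R and Om' = Omega R' this gives, by contraction_Omega below,
     (-1)^(deg R' (deg u_1 + .. + deg u_k))
       Bt (R (u_1, .., u_k)) (R' (u_(k+1), .., u_(k+k'))),
   i.e. the value of Bt o (R (x) R') with R' treated as a graded letter. Without
   this sign {Omega Qt, Omega Qt} would not vanish for odd elements. *)
Definition contraction (N : nat) (e e' : N.-tuple Vt) (k k' : nat)
    (Om : (Vt ^ k.+1)%type -> K^o) (Om' : (Vt ^ k'.+1)%type -> K^o) :
    (Vt ^ (k + k'))%type -> K^o :=
  by_parity gVt1 (fun p u =>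
    \sum_(i < N) \sum_(b : bool)
      (-1) ^+ ((\big[addb/false]_(j < k) p (lshift k' j)) &&
               ((\big[addb/false]_(j < k') p (rshift k j)) (+) b)) *
      (Om (ff_snoc [ffun j => u (lshift k' j)] (sgn gVt1 e`_i)) *
       Om' (ff_snoc [ffun j => u (rshift k j)] (par gVt1 b e'`_i)))).

Definition pinczon (N : nat) (e e' : N.-tuple Vt) (k k' : nat)
    (Om : (Vt ^ k.+1)%type -> K^o) (Om' : (Vt ^ k'.+1)%type -> K^o) :
    (Vt ^ (k + k'))%type -> K^o :=
  cycl gVt1 (contraction e e' Om Om').

Definition dP (N : nat) (e e' : N.-tuple Vt) (k : nat)
    (R : (Vt ^ k)%type -> Vt) : (Vt ^ k.+1)%type -> Vt :=
  map_of_form (pinczon e e' (Omega Qt) (Omega R) : (Vt ^ k.+2)%type -> K^o).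

Definition ext0 (n : nat) (D : (V ^ n)%type -> M) (u : (Vt ^ n)%type) : Vt :=
  ((0, D [ffun i => (u i).1.1]), 0).

Definition tilde (n : nat) (D : (V ^ n)%type -> M) : (Vt ^ n)%type -> Vt :=
  map_of_form (cycl gVt1 (Omega (ext0 D))).

Definition cochain (k : nat) (c : (V ^ k)%type -> M) : Prop :=
  multilinear c /\
  forall (d : 'I_k -> int) (x : (V ^ k)%type),
    (forall i, homog gV (d i) (x i)) ->
    homog gM (\sum_i d i + (2 - k%:Z)) (c x).

Definition Phi (k : nat) (c : (V ^ k)%type -> M) : (Vt ^ k)%type -> Vt :=
  tilde (shiftmap gV1 c).

(* The Hochschild coboundary [Q, C], for C of degree 1 on V[1]. *)
Definition dH (k : nat) (C : (V ^ k)%type -> M) : (V ^ k.+1)%type -> M :=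
  by_parity gV1 (fun p x =>
    (-1) ^+ p ord0 *: shift2 gV1 l (x ord0) (C (ff_tail x))
    + shift2 gM1 r (C (ff_init x)) (x ord_max)
    + \sum_(i < k) (-1) ^+ (\big[addb/false]_(j < k.+1 | (j < i)%N) p j) *:
        C (ff_merge (shift2 gV1 q) i x)).

End DoubleSemiDirectProduct.

Section BtTheory.
Variables (K : fieldType) (V M : vectType K) (gV : grading V) (gM : grading M).
Local Notation bt := (bt gV gM).
Local Notation Bt := (Bt gV gM).
Local Notation g1 := (gVt1 gV gM).
Local Notation Vt := (Vt V M).

Lemma ev_linear_l (w : W V M) : linear (fun f : Wd V M => ev f w : K^o).
Proof.
move=> a f h; rewrite /ev /= !add_lfunE !scale_lfunE scalerDr.
by rewrite addrACA.
Qed.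
Lemma ev_linear_r (f : Wd V M) : linear (fun w : W V M => ev f w : K^o).
Proof. by move=> a w w'; rewrite /ev /= !linearP /= scalerDr addrACA. Qed.

Lemma ev_par b f w : ev (par (gWd gV gM) b f) w = ev f (par (gW gV gM) b w).
Proof. by rewrite /ev !par_gprod /= !par_gdual. Qed.

Lemma bt_sgn (u v : Vt) : bt u v = ev u.2 v.1 + ev v.2 (sgn (gW gV gM) u.1).
Proof.
rewrite /bt; congr (_ + _).
under eq_bigr => s _ do
  (under eq_bigr => p _ do rewrite ev_par parK; rewrite big_bool /=).
rewrite big_bool /= !expr0 !mul1r !expr1 mulN1r.
have e0 : ev v.2 0 = 0 by rewrite /ev !linear0 addr0.
have -> : sgn (gW gV gM) u.1
    = -1 *: par (gW gV gM) true u.1 + par (gW gV gM) false u.1.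
  by rewrite scaleN1r addrC.
by rewrite (ev_linear_r v.2) scaleN1r e0 addr0 add0r.
Qed.

Lemma bt_linear_l (v : Vt) : linear (fun u : Vt => bt u v : K^o).
Proof.
move=> a u u'; rewrite !bt_sgn (ev_linear_l v.1) linearP (ev_linear_r v.2).
by rewrite [in RHS]scalerDr addrACA.
Qed.

Lemma bt_linear_r (u : Vt) : linear (fun v : Vt => bt u v : K^o).
Proof.
move=> a v v'; rewrite !bt_sgn (ev_linear_r u.2) (ev_linear_l (sgn _ u.1)).
by rewrite [in RHS]scalerDr addrACA.
Qed.

Lemma bt_par b u v : bt (par g1 b u) v = bt u (par g1 b v).
Proof.
rewrite !bt_sgn !par_gshift !(par_gprod (gW gV gM) (gWd gV gM)) /=.
rewrite !ev_par sgn_par -par_sgn.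
by [].
Qed.

Lemma Bt_linear_l (v : Vt) : linear (fun u : Vt => Bt u v : K^o).
Proof. by move=> a u u'; rewrite /Bt linearP (bt_linear_l v). Qed.
Lemma Bt_linear_r (u : Vt) : linear (fun v : Vt => Bt u v : K^o).
Proof. exact: bt_linear_r. Qed.

Lemma linear_comb (f : Vt -> K^o) N (c : 'I_N -> K) (x : 'I_N -> Vt) :
  linear f -> f (\sum_(i < N) c i *: x i) = \sum_(i < N) c i * f (x i).
Proof.
move=> fP; pose ln := GRing.isLinear.Build K Vt K^o *:%R f fP.
pose L : {linear Vt -> K^o} := HB.pack f ln.
rewrite -[f]/(L : Vt -> K^o) linear_sum.
by apply: eq_bigr => i _; rewrite linearZ.
Qed.

Lemma Bt_expand N (e e' : N.-tuple Vt) :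
  basis_of fullv e -> (forall i j : 'I_N, bt e`_i e'`_j = (i == j)%:R) ->
  forall b x y, \sum_(i < N) Bt x (sgn g1 e`_i) * Bt y (par g1 b e'`_i)
    = Bt x (par g1 b y).
Proof.
move=> be de b x y.
pose z := par g1 b (sgn g1 y).
have zE : z = \sum_(i < N) bt z e'`_i *: e`_i.
  rewrite {1}(coord_basis be (memvf z)); apply: eq_bigr => i _; congr (_ *: _).
  rewrite {2}(coord_basis be (memvf z)).
  rewrite (linear_comb _ _ (bt_linear_l e'`_i)) (bigD1 i) //= de eqxx mulr1.
  by rewrite big1 ?addr0 // => j /negPf ji; rewrite de ji mulr0.
have -> : par g1 b y = sgn g1 z.
  by rewrite /z par_sgn linearZ /= sgn_par scalerA -expr2 sqrr_sign scale1r.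
have sgn_z : sgn g1 z = \sum_(i < N) bt z e'`_i *: sgn g1 e`_i.
  rewrite {1}zE linear_sum; apply: eq_bigr => i _; exact: linearZ.
rewrite sgn_z (linear_comb _ _ (Bt_linear_r x)).
apply: eq_bigr => i _; rewrite mulrC; congr (_ * _).
by rewrite /z bt_par.
Qed.

(* In this sum deg R' is the parity b of R'(u) minus that of u. *)
Lemma contraction_Omega N (e e' : N.-tuple Vt) :
  basis_of fullv e -> (forall i j : 'I_N, bt e`_i e'`_j = (i == j)%:R) ->
  forall k k' (R : (Vt ^ k)%type -> Vt) (R' : (Vt ^ k')%type -> Vt),
  contraction gV gM e e' (Omega gV gM R) (Omega gV gM R') =1
  by_parity g1 (fun p u => \sum_(b : bool)
    (-1) ^+ ((\big[addb/false]_(j < k) p (lshift k' j)) &&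
             ((\big[addb/false]_(j < k') p (rshift k j)) (+) b)) *
    Bt (R [ffun j => u (lshift k' j)]) (par g1 b (R' [ffun j => u (rshift k j)]))).
Proof.
move=> be de k k' R R' u; apply: eq_bigr => p _.
rewrite exchange_big /=; apply: eq_bigr => b _.
rewrite -mulr_sumr; congr (_ * _); rewrite -[RHS](Bt_expand be de).
have initE n (v : (Vt ^ n)%type) x : ff_init (ff_snoc v x) = v.
  by apply/ffunP => i; rewrite !ffunE liftK.
apply: eq_bigr => i _; rewrite /Omega !initE !ffunE !unlift_none.
by [].
Qed.

Lemma functionals_sep (U : vectType K) (x : U) :
  (forall f : 'Hom(U, K^o), f x = 0) -> x = 0.
Proof.
move=> x0; rewrite (coord_vbasis (memvf x)) big1 // => i _.
have := x0 (linfun (coord (vbasis {:U}) i : U -> K^o)).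
by rewrite lfunE /= => ->; rewrite scale0r.
Qed.

Lemma ev_nondeg_l (f : Wd V M) : (forall w, ev f w = 0) -> f = 0.
Proof.
move=> f0; rewrite [f]surjective_pairing; congr pair; apply/lfunP => x.
  by have := f0 (x, 0); rewrite /ev /= linear0 addr0 lfunE.
by have := f0 (0, x); rewrite /ev /= linear0 add0r lfunE.
Qed.

Lemma ev_nondeg_r (w : W V M) : (forall f, ev f w = 0) -> w = 0.
Proof.
move=> w0; rewrite [w]surjective_pairing; congr pair; apply: functionals_sep => f.
  by have := w0 (f, 0); rewrite /ev /= lfunE addr0.
by have := w0 (0, f); rewrite /ev /= lfunE add0r.
Qed.

Lemma Bt_nondeg (u : Vt) : (forall v, Bt u v = 0) -> u = 0.
Proof.
move=> u0; rewrite -[u](sgnK g1) -[RHS](linear0 (sgn g1)); congr (sgn _ _).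
have {}u0 v : bt (sgn g1 u) v = 0 := u0 v.
move: (sgn g1 u) u0 => {}u u0; rewrite [u]surjective_pairing; congr pair.
  rewrite -[u.1](sgnK (gW gV gM)) -[RHS](linear0 (sgn (gW gV gM))).
  congr (sgn _ _); apply: ev_nondeg_r => f.
  by have := u0 (0, f); rewrite bt_sgn /= {1}/ev !linear0 addr0 add0r.
apply: ev_nondeg_l => w; have := u0 (w, 0).
by rewrite bt_sgn /= {2}/ev /= !lfunE addr0 addr0.
Qed.

Lemma Omega_map_of_form k (Om : (Vt ^ k.+1)%type -> K^o) :
  multilinear Om -> Omega gV gM (map_of_form gV gM Om) =1 Om.
Proof.
move=> OmP u; rewrite /Omega /map_of_form.
set w := ff_init u; set v := u ord_max.
have snocP : ff_snoc w v = u.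
  apply/ffunP => i; rewrite !ffunE; case: unliftP => [j ->|->] //.
  by rewrite ffunE.
have BE x y : linfun (Bt x : Vt -> K^o) y = Bt x y.
  pose ln := GRing.isLinear.Build K Vt K^o *:%R _ (Bt_linear_r x).
  pose L : {linear Vt -> K^o} := HB.pack (Bt x : Vt -> K^o) ln.
  exact: (lfunE L).
have bP : linear (fun x : Vt => linfun (Bt x : Vt -> K^o)).
  move=> a x y; apply/lfunP => z; rewrite add_lfunE scale_lfunE.
  apply: etrans (BE _ _) (etrans (Bt_linear_l z a x y) _).
  exact: esym (congr2 (fun s t : K^o => a *: s + t) (BE x z) (BE y z)).
pose lb := GRing.isLinear.Build K Vt 'Hom(Vt, K^o) *:%R _ bP.
pose Lb : {linear Vt -> 'Hom(Vt, K^o)} :=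
  HB.pack (fun x : Vt => linfun (Bt x : Vt -> K^o)) lb.
set beta := linfun _.
have betaE x : beta x = linfun (Bt x : Vt -> K^o) by exact: (lfunE Lb).
have ker0 : lker beta == 0%VS.
  apply/lker0P => x y; rewrite !betaE => /lfunP xy; apply/eqP.
  rewrite -subr_eq0; apply/eqP/Bt_nondeg => z.
  rewrite addrC -scaleN1r; apply: etrans (Bt_linear_l z (-1) y x) _.
  have -> : Bt x z = Bt y z := etrans (esym (BE x z)) (etrans (xy z) (BE y z)).
  by rewrite scaleN1r addNr.
have imf : limg beta = fullv.
  apply/eqP; rewrite eqEdim subvf /= limg_dim_eq; last by rewrite (eqP ker0) capv0.
  by rewrite !dimvf /dim /= muln1.
have snoc_lin : linear (fun x : Vt => Om (ff_snoc w x)).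
  move=> a x y; have := OmP u ord_max a x y.
  have E z : [ffun j => if j == ord_max then z else u j] = ff_snoc w z.
    apply/ffunP => i; rewrite !ffunE; case: unliftP => [j ->|->].
      by rewrite eq_sym (negPf (neq_lift _ _)) ffunE.
    by rewrite eqxx.
  by rewrite !E.
pose lO := GRing.isLinear.Build K Vt K^o *:%R _ snoc_lin.
pose LO : {linear Vt -> K^o} := HB.pack (fun x : Vt => Om (ff_snoc w x)) lO.
rewrite -BE -betaE limg_lfunVK ?imf ?memvf //.
by rewrite (lfunE LO) /= snocP.
Qed.

End BtTheory.

(* Main.v *)
From HB Require Import structures.
Require Import Defs.
From mathcomp Require Import all_boot all_order all_algebra all_fingroup.
From mathcomp Require Import cyclic zify ring.

(** On homogeneous arguments the contraction of Omega Qt with Omega Ct is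
    (u_0, .., u_(k+1)) |-> Omega Ct (u_2, .., u_(k+1), Qt (u_0, u_1)), without
    sign. Expanding Omega Ct as the sum of the rotations of Omega C' gives k+1
    terms: when Qt (u_0, u_1) stays in the last slot, its two M*-components
    yield the terms Q (x, C) and Q (C, x) of the Hochschild coboundary; when it
    is rotated into a slot of C, it yields C (.., Q (x_r, x_(r+1)), ..).
    Each of them is a rotation of the corresponding term of Omega (ext0 dH), and
    the cyclic sum does not see rotations. The signs agree because a rotation
    by m has Koszul sign 1 on arguments of odd total parity, and the parity of
    the first m letters on arguments of even total parity. *)

Set Implicit Arguments.
Unset Strict Implicit.
Unset Printing Implicit Defensive.

Import GRing.Theory.
Local Open Scope ring_scope.

(** Every signed operation is a [by_parity] sum, a formula for homogeneous arguments extended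
    linearly, so no sign identity can be read off at an arbitrary tuple. Multilinearity is therefore
    carried through the constructions: it reduces identities to tuples with a parity profile, and
    there it collapses each [by_parity] sum to a single term. Signs see only parities, so the
    integer degree 2 - k is used once, to show that the shifted map C is odd. [Bt] vanishes between
    vectors of different parity. Hence the form of the odd map C lives on arguments of odd total
    parity and that of its coboundary on even total parity, and replacing two arguments by their odd
    product exchanges the two. This keeps the two regimes of rotation signs apart: rotating the form
    of C costs no sign, while on the coboundary side the rotation signs are matched against those of
    [dH] and of the shifted products. *)

Definition phomog (K : fieldType) (U : vectType K) (g : grading U) (n : nat)
    (p : {ffun 'I_n -> bool}) (u : (U ^ n)%type) : Prop :=
  forall i, par g (p i) (u i) = u i.

Definition tot (n : nat) (p : {ffun 'I_n -> bool}) : bool :=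
  \big[addb/false]_(i < n) p i.

(** * Multilinear maps and reduction to tuples with a parity profile *)

Section Multilinear.
Variables (K : fieldType) (U : vectType K) (g : grading U).

(** Linearity in a slot is phrased as a relation between three tuples, so that it can be transported
    along permutations, truncations and merges without computing with updated finite functions. *)
Definition slotcomb n (i : 'I_n) (a : K) (u v w : (U ^ n)%type) : Prop :=
  w i = a *: u i + v i /\ forall j, j != i -> u j = w j /\ v j = w j.

Lemma multilinearP n (Y : lmodType K) (f : (U ^ n)%type -> Y) :
  multilinear f <->
  forall i a u v w, slotcomb i a u v w -> f w = a *: f u + f v.
Proof.
split=> [fP i a u v w [wi wj]|fP u i a x y].
  have eqU z (t : (U ^ n)%type) : (forall j, j != i -> t j = w j) -> t i = z ->
      t = [ffun j => if j == i then z else w j].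
    by move=> tw ti; apply/ffunP => j; rewrite ffunE; case: eqP => [->|/eqP/tw].
  rewrite (eqU (a *: u i + v i) w) // fP.
  by rewrite -(eqU (u i) u) -?(eqU (v i) v) // => j /wj [].
apply: (fP i); split=> [|j /negPf ji]; first by rewrite !ffunE eqxx.
by rewrite !ffunE ji.
Qed.

Lemma multilinear0 n (Y : lmodType K) (f : (U ^ n)%type -> Y) (u : (U ^ n)%type) i :
  multilinear f -> u i = 0 -> f u = 0.
Proof.
(* A tuple whose slot i is zero is the combination, at i, of itself with itself; this gives f u = f
   u + f u. *)
move=> /multilinearP fP ui; have := fP i 1 u u u.
rewrite scale1r => /(_ _)/eqP; rewrite -subr_eq subrr eq_sym => fu.
by apply/eqP/fu; split=> //; rewrite ui scaler0 addr0.
Qed.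

Lemma eq_multilinear n (Y : lmodType K) (f h : (U ^ n)%type -> Y) :
  f =1 h -> multilinear f -> multilinear h.
Proof.
move=> fh /multilinearP fP; apply/multilinearP => i a u v w uvw.
by rewrite -!fh; apply: fP uvw.
Qed.

Lemma multilinear_sum n (Y : lmodType K) (I : Type) (s : seq I) (P : pred I)
    (f : I -> (U ^ n)%type -> Y) :
  (forall i, multilinear (f i)) -> multilinear (fun u => \sum_(i <- s | P i) f i u).
Proof.
move=> fP; apply/multilinearP => i a u v w uvw.
rewrite scaler_sumr -big_split /=; apply: eq_bigr => j _.
by have /multilinearP := fP j; apply; apply: uvw.
Qed.

Lemma multilinear_comb n (Y : lmodType K) b (f h : (U ^ n)%type -> Y) :
  multilinear f -> multilinear h -> multilinear (fun u => b *: f u + h u).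
Proof.
move=> /multilinearP fP /multilinearP hP; apply/multilinearP => i a u v w uvw.
rewrite (fP _ _ _ _ _ uvw) (hP _ _ _ _ _ uvw) !scalerDr !scalerA mulrC.
by rewrite addrACA.
Qed.

Lemma multilinearZ n (Y : lmodType K) b (f : (U ^ n)%type -> Y) :
  multilinear f -> multilinear (fun u => b *: f u).
Proof.
move=> /multilinearP fP; apply/multilinearP => i a u v w uvw.
by rewrite (fP _ _ _ _ _ uvw) !scalerDr !scalerA mulrC.
Qed.

Lemma multilinearD n (Y : lmodType K) (f h : (U ^ n)%type -> Y) :
  multilinear f -> multilinear h -> multilinear (fun u => f u + h u).
Proof.
move=> fP hP; apply: eq_multilinear (multilinear_comb 1 fP hP) => u.
by rewrite scale1r.
Qed.

Lemma linear_multilinear n (Y Z : lmodType K) (f : (U ^ n)%type -> Y)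
    (h : Y -> Z) : linear h -> multilinear f -> multilinear (fun u => h (f u)).
Proof.
move=> hP /multilinearP fP; apply/multilinearP => i a u v w uvw.
by rewrite (fP _ _ _ _ _ uvw) hP.
Qed.

Lemma slotcomb_perm n (s : 'S_n) (i : 'I_n) a u v w : slotcomb (s i) a u v w ->
  slotcomb i a [ffun j => u (s j)] [ffun j => v (s j)] [ffun j => w (s j)].
Proof.
case=> wi wj; split=> [|j ji]; rewrite !ffunE //.
by apply: wj; rewrite (inj_eq perm_inj).
Qed.

Lemma slotcomb_par n (p : {ffun 'I_n -> bool}) i a u v w :
  slotcomb i a u v w ->
  slotcomb i a [ffun j => par g (p j) (u j)] [ffun j => par g (p j) (v j)]
           [ffun j => par g (p j) (w j)].
Proof.
case=> wi wj; split=> [|j ji]; rewrite !ffunE; first by rewrite wi linearP.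
by have [-> ->] := wj _ ji.
Qed.

Lemma multilinear_by_parity n (Y : lmodType K) F :
  (forall p, multilinear (F p)) ->
  multilinear (by_parity g F : (U ^ n)%type -> Y).
Proof.
move=> FP; apply: multilinear_sum => p; apply/multilinearP => i a u v w uvw.
have /multilinearP := FP p; apply; exact: slotcomb_par uvw.
Qed.

Lemma phomog_par n (p : {ffun 'I_n -> bool}) (u : (U ^ n)%type) :
  phomog g p [ffun i => par g (p i) (u i)].
Proof. by move=> i; rewrite ffunE parK eqxx. Qed.

(** A profile other than p differs from it at some slot, and the projection there kills the
    argument. *)
Lemma by_parity_homog n (Y : zmodType) (F : _ -> (U ^ n)%type -> Y) p
    (u : (U ^ n)%type) :
  (forall p (v : (U ^ n)%type) i, v i = 0 -> F p v = 0) -> phomog g p u ->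
  by_parity g F u = F p u.
Proof.
move=> F0 pu; rewrite /by_parity (bigD1 p) //= big1 ?addr0 => [|p' pp'].
  by congr F; apply/ffunP => i; rewrite ffunE.
have [i pi] : exists i, p' i != p i.
  apply/existsP; apply: contraR pp' => /existsPn pp'; apply/eqP/ffunP => i.
  exact/eqP/negPn/pp'.
by apply: (F0 _ _ i); rewrite ffunE -(pu i) parK (negPf pi).
Qed.

Lemma by_parity_multilinear n (Y : lmodType K) (F : _ -> (U ^ n)%type -> Y) p u :
  (forall p, multilinear (F p)) -> phomog g p u ->
  by_parity g F u = F p u.
Proof. by move=> FP; apply: by_parity_homog => p' v i; apply: multilinear0. Qed.

Lemma eq_by_parity n (Y : zmodType) (F F' : _ -> (U ^ n)%type -> Y) :
  (forall p u, phomog g p u -> F p u = F' p u) ->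
  by_parity g F =1 by_parity g F'.
Proof. by move=> FF u; apply: eq_bigr => p _; apply/FF/phomog_par. Qed.

(** The class S is left free because it serves twice: vectors of some parity in [eq_homog], vectors
    of an integer degree of prescribed parity in [cochain_parity]. *)
Lemma multilinear_vanish n (Y : lmodType K) (h : (U ^ n)%type -> Y)
    (S : 'I_n -> U -> Prop) (u : (U ^ n)%type) :
  multilinear h ->
  (forall v : (U ^ n)%type, (forall i, S i (v i)) -> h v = 0) ->
  (forall i, exists2 s : seq U, u i = \sum_(x <- s) x &
     forall x, x \in s -> S i x) ->
  h u = 0.
Proof.
move=> hP hS us.
(* The first m slots still hold the entries of u, the others are already in S; each step decomposes
   slot m - 1. *)
suff H m (v : (U ^ n)%type) : (m <= n)%N ->
    (forall i : 'I_n, if (i < m)%N then v i = u i else S i (v i)) -> h v = 0.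
  by apply: (H n) => // i; rewrite ltn_ord.
elim: m v => [|m IHm] v mn vP; first by apply: hS => i; apply: vP i.
pose i := Ordinal mn; have [s ui sS] := us i.
have vE : v = [ffun j => if j == i then \sum_(x <- s) x else v j].
  apply/ffunP => j; rewrite ffunE; case: eqP => [->|//].
  by have := vP i; rewrite ltnSn -ui.
rewrite vE; elim: s {ui vE} sS => [|x s IHs] sS.
  by rewrite big_nil; apply: (multilinear0 (i := i) hP); rewrite ffunE eqxx.
rewrite big_cons -[x]scale1r hP IHs => [|y ys]; last first.
  by apply: sS; rewrite inE ys orbT.
rewrite addr0 IHm ?scaler0 ?(ltnW mn) // => j; rewrite ffunE.
have := vP j; rewrite ltnS [(j <= m)%N]leq_eqVlt; case: (j =P i) => [-> _|ji].
  by rewrite ltnn; apply: sS; rewrite inE eqxx.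
suff -> : (j == m :> nat) = false by [].
by apply/eqP => jm; apply: ji; apply/val_inj.
Qed.

Lemma eq_homog n (Y : lmodType K) (f h : (U ^ n)%type -> Y) :
  multilinear f -> multilinear h ->
  (forall p u, phomog g p u -> f u = h u) -> f =1 h.
Proof.
move=> fP hP fh u; apply/eqP; rewrite -subr_eq0 addrC -scaleN1r; apply/eqP.
apply: (multilinear_vanish (S := fun _ x => exists b, par g b x = x)
          (multilinear_comb (-1) hP fP)) => [v vS|i]; last first.
  exists [:: par g false (u i); par g true (u i)].
    by rewrite !big_cons big_nil addr0 par_sum.
  move=> x; rewrite !inE => /orP[] /eqP ->; [exists false|exists true];
    by rewrite parK eqxx.
suff [p pv] : exists p, phomog g p v by rewrite (fh _ _ pv) scaleN1r addNr.
(* Each slot is even or odd, so testing for odd determines a profile; a zero slot is counted as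
   odd. *)
exists [ffun i => par g true (v i) == v i] => i; rewrite ffunE.
by case: eqP => // vi; case: (vS i) => [[]].
Qed.

End Multilinear.

(** * Koszul signs: cocycle identity and the sign of a rotation *)

Section KoszulSign.

Lemma addb_sym_eq0 n (G : 'I_n -> 'I_n -> bool) :
  (forall i j, G i j = G j i) -> (forall i, G i i = false) ->
  \big[addb/false]_(i < n) \big[addb/false]_(j < n) G i j = false.
Proof.
move=> Gsym Gdiag.
pose L := \big[addb/false]_(i < n) \big[addb/false]_(j < n) ((i < j)%N && G i j).
suff -> : \big[addb/false]_(i < n) \big[addb/false]_(j < n) G i j = L (+) L.
  exact: addbb.
have {2}-> : L = \big[addb/false]_(i < n) \big[addb/false]_(j < n)
    ((j < i)%N && G i j).
  by rewrite exchange_big /=; do 2![apply: eq_bigr => ? _]; rewrite Gsym.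
rewrite -big_split /=; apply: eq_bigr => i _; rewrite -big_split /=.
apply: eq_bigr => j _; case: ltngtP => //= [|/val_inj ->]; first by rewrite addbF.
exact: Gdiag.
Qed.

(** Once the inversions of s are reindexed by t, all three counts run over the same pairs (i, j).
    Their sum modulo 2 is symmetric in i and j, because an unordered pair is inverted by the
    composite exactly when one of the two factors inverts it; [addb_sym_eq0] then cancels the
    pairs. *)
Lemma koszulM n (s t : 'S_n) p :
  koszul (t * s)%g p = koszul s p (+) koszul t [ffun i => p (s i)].
Proof.
have koszulE s' p' : koszul s' p' = \big[addb/false]_(i < n)
    \big[addb/false]_(j < n) [&& i < j, s' j < s' i & p' (s' i) && p' (s' j)]%N.
  apply: eq_bigr => i _; rewrite big_mkcond; apply: eq_bigr => j _.
  by case: (i < j)%N => //=; case: (_ < _)%N.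
suff : koszul (t * s)%g p (+) (koszul s p (+) koszul t [ffun i => p (s i)])
    = false by do 3![case: koszul].
rewrite !koszulE [X in _ (+) (X (+) _)](reindex_inj (perm_inj (s := t))) /=.
under [X in _ (+) (X (+) _)]eq_bigr => i _ do
  rewrite (reindex_inj (perm_inj (s := t))) /=.
rewrite -!big_split /=; under eq_bigr do rewrite -!big_split /=.
apply: addb_sym_eq0 => [i j|i]; last by rewrite !ltnn.
rewrite !permM !ffunE [p _ && p (s (t i))]andbC; case: (eqVneq i j) => [->//|ij].
have tij : t i != t j by rewrite (inj_eq perm_inj).
have stij : s (t i) != s (t j) by rewrite (inj_eq perm_inj).
move: ij tij stij; rewrite -!(inj_eq val_inj) /=.
move: (p _ && p _) => b.
by case: (ltngtP i j); case: (ltngtP (t i) (t j));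
  case: (ltngtP (s (t i)) (s (t j))); case: b.
Qed.

Lemma reindex_koszul n (s : 'S_n) (P : pred 'I_n) (p : {ffun 'I_n -> bool}) :
  \big[addb/false]_(i < n | P (s i)) p (s i) = \big[addb/false]_(i < n | P i) p i.
Proof. by rewrite [RHS](reindex_inj (perm_inj (s := s))). Qed.

(** The inversions are the pairs formed by a letter of index at least m and a letter of index below
    m, so the sign is the product of the parities A and B of these two blocks. Since A + B is the
    total parity, A && B is B && ~~ [tot p]. *)
Lemma koszul_rot n m (s : 'S_n) p : (m <= n)%N ->
  (forall i : 'I_n, s i = (i + m) %% n :> nat)%N ->
  koszul s p = \big[addb/false]_(i < n | (i < m)%N) p i && ~~ tot p.
Proof.
move=> mn sE.
have sE' (i : 'I_n) : s i = (if (i < n - m)%N then i + m else i + m - n)%N :> nat.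
  rewrite sE; case: ifP => im; first by rewrite modn_small; lia.
  have -> : (i + m = (i + m - n) + n)%N by lia.
  by rewrite modnDr modn_small; have := ltn_ord i; lia.
have -> : koszul s p = \big[addb/false]_(i < n | ~~ (s i < m)%N) p (s i)
    && \big[addb/false]_(j < n | (s j < m)%N) p (s j).
  rewrite (big_distrl _ (times := andb)) /= [RHS]big_mkcond.
  have sm (i : 'I_n) : (s i < m)%N = (n - m <= i)%N.
    by rewrite sE'; have := ltn_ord i; case: ifP; lia.
  apply: eq_bigr => i _; rewrite sm -ltnNge; case: ifP => im; last first.
    rewrite big_pred0 // => j; rewrite !sE' im.
    by have := ltn_ord i; have := ltn_ord j; case: ifP; lia.
  rewrite big_distrr /=; apply: eq_bigl => j; rewrite sm !sE' im.
  by have := ltn_ord i; have := ltn_ord j; case: ifP; lia.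
rewrite (reindex_koszul s (fun i => ~~ (i < m)%N)).
rewrite (reindex_koszul s (fun i : 'I_n => (i < m)%N)).
rewrite /tot [\big[_/_]_(i < n) p i](bigID (fun i : 'I_n => (i < m)%N)) /=.
by do 2!case: (\big[_/_]_(_ | _) _).
Qed.

End KoszulSign.

(** * The action of permutations on forms and the cyclic sum *)

Section CyclicForms.
Variables (K : fieldType) (U : vectType K) (g : grading U).

Lemma phomog_perm n p (u : (U ^ n)%type) (s : 'S_n) : phomog g p u ->
  phomog g [ffun i => p (s i)] [ffun i => u (s i)].
Proof. by move=> pu i; rewrite !ffunE pu. Qed.

Lemma perm_form_multilinear_sign n (s : 'S_n) b (Om : (U ^ n)%type -> K^o) :
  multilinear Om -> multilinear (fun u => b * Om [ffun i => u (s i)] : K^o).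
Proof.
move=> /multilinearP OmP; apply: multilinearZ; apply/multilinearP.
move=> i a u v w uvw; apply: (OmP (s^-1%g i)).
by apply: slotcomb_perm; rewrite permKV.
Qed.

Lemma multilinear_perm_form n (s : 'S_n) (Om : (U ^ n)%type -> K^o) :
  multilinear Om -> multilinear (perm_form g s Om).
Proof.
by move=> OmP; apply: multilinear_by_parity => p; apply: perm_form_multilinear_sign.
Qed.

Lemma multilinear_cycl n (Om : (U ^ n)%type -> K^o) :
  multilinear Om -> multilinear (cycl g Om).
Proof. by move=> OmP; apply: multilinear_sum => s; apply: multilinear_perm_form. Qed.

Lemma perm_form_homog n (s : 'S_n) (Om : (U ^ n)%type -> K^o) p u :
  multilinear Om -> phomog g p u ->
  perm_form g s Om u = (-1) ^+ koszul s p * Om [ffun i => u (s i)].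
Proof.
move=> OmP pu; apply: (by_parity_multilinear (F := fun p u => _)) pu => {}p.
exact: perm_form_multilinear_sign.
Qed.

(** A permuted form is evaluated at homogeneous tuples only, so agreement there suffices, with no
    multilinearity assumed. This allows the contraction to be replaced under [cycl]. *)
Lemma eq_perm_form n (s : 'S_n) (f h : (U ^ n)%type -> K^o) :
  (forall p u, phomog g p u -> f u = h u) -> perm_form g s f =1 perm_form g s h.
Proof.
move=> fh; apply: eq_by_parity => p u pu.
by rewrite (fh _ _ (phomog_perm s pu)).
Qed.

Lemma eq_cycl n (f h : (U ^ n)%type -> K^o) :
  (forall p u, phomog g p u -> f u = h u) -> cycl g f =1 cycl g h.
Proof. by move=> fh u; apply: eq_bigr => s _; apply: eq_perm_form. Qed.

Lemma perm_form_sum n (s : 'S_n) (I : Type) (r : seq I) (P : pred I)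
    (f : I -> (U ^ n)%type -> K^o) u :
  perm_form g s (fun v => \sum_(i <- r | P i) f i v) u =
  \sum_(i <- r | P i) perm_form g s (f i) u.
Proof.
rewrite /perm_form /by_parity [RHS]exchange_big; apply: eq_bigr => p _ /=.
exact: mulr_sumr.
Qed.

Lemma perm_formM n (s t : 'S_n) (Om : (U ^ n)%type -> K^o) : multilinear Om ->
  perm_form g s (perm_form g t Om) =1 perm_form g (t * s)%g Om.
Proof.
move=> OmP; have tP := multilinear_perm_form t OmP.
apply: (eq_homog (g := g)) => [||p u pu].
- exact: multilinear_perm_form.
- exact: multilinear_perm_form.
rewrite (perm_form_homog _ tP pu) (perm_form_homog _ OmP (phomog_perm s pu)).
rewrite (perm_form_homog _ OmP pu) mulrA -signr_addb koszulM; congr (_ * Om _).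
by apply/ffunP => i; rewrite !ffunE permM.
Qed.

Lemma cycl_perm_form n (s : 'S_n) (Om : (U ^ n)%type -> K^o) :
  multilinear Om -> s \in <[cycle_perm n]>%g ->
  cycl g (perm_form g s Om) =1 cycl g Om.
Proof.
move=> OmP sc u; rewrite /cycl [RHS](reindex_inj (mulgI s)) /=.
apply: eq_big => [t|t _]; first by rewrite groupMl.
exact: perm_formM.
Qed.

Lemma perm_form_cycl n (s : 'S_n) (Om : (U ^ n)%type -> K^o) :
  multilinear Om -> s \in <[cycle_perm n]>%g ->
  perm_form g s (cycl g Om) =1 cycl g Om.
Proof.
move=> OmP sc u; rewrite perm_form_sum /cycl [RHS](reindex_inj (mulIg s)) /=.
apply: eq_big => [t|t _]; first by rewrite groupMr.
exact: perm_formM.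
Qed.

Lemma cycle_permX n m (i : 'I_n) :
  ((cycle_perm n ^+ m)%g i = (i + m) %% n :> nat)%N.
Proof.
elim: m i => [|m IHm] i; first by rewrite perm1 addn0 modn_small.
by rewrite expgSr permM permE /= IHm -addn1 modnDml addn1 addnS.
Qed.

Lemma order_cycle_perm n : #[cycle_perm n.+1]%g = n.+1.
Proof.
apply/eqP; rewrite eqn_dvd; apply/andP; split.
  rewrite order_dvdn; apply/eqP/permP => i; apply/val_inj.
  by rewrite /= cycle_permX modnDr modn_small // perm1.
have := congr1 (fun s : 'S_n.+1 => s ord0 : nat) (expg_order (cycle_perm n.+1)).
by rewrite perm1 cycle_permX => /eqP.
Qed.

(** The powers of the cycle below n + 1 are distinct because the m-th one sends 0 to m. *)
Lemma cycl_sum n (Om : (U ^ n.+1)%type -> K^o) u :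
  cycl g Om u = \sum_(m < n.+1) perm_form g (cycle_perm n.+1 ^+ m)%g Om u.
Proof.
pose c := cycle_perm n.+1.
transitivity (\sum_(s in [set (c ^+ m)%g | m : 'I_n.+1]) perm_form g s Om u).
  apply: eq_bigl => s; apply/idP/imsetP => [|[m _ ->]]; last exact: mem_cycle.
  case/cyclePmin => m; rewrite order_cycle_perm => mn ->.
  by exists (Ordinal mn).
rewrite big_imset // => m m' _ _ mm'; apply/val_inj.
have := congr1 (fun s : 'S_n.+1 => s ord0 : nat) mm'.
by rewrite !cycle_permX !add0n !modn_small.
Qed.

Lemma koszul_cycle_permX n m (p : {ffun 'I_n -> bool}) : (m <= n)%N ->
  koszul (cycle_perm n ^+ m)%g p =
  \big[addb/false]_(i < n | (i < m)%N) p i && ~~ tot p.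
Proof. by move=> mn; apply: koszul_rot => // i; apply: cycle_permX. Qed.

End CyclicForms.

(** * From integer degrees to parities *)

Section ParityOfValues.
Variable K : fieldType.

Lemma homog_par (U : vectType K) (g : grading U) n x :
  homog g n x -> par g (odd `|n|%N) x = x.
Proof.
move=> nx; rewrite -[RHS](par_sum g); set b := odd _.
have -> : par g (~~ b) x = 0 -> par g false x + par g true x = par g b x.
  by case: b => /= ->; rewrite ?addr0 ?add0r.
  by [].
rewrite -nx /par big1 // => m /eqP mb; rewrite gpartK; case: eqP => // mn.
by move: mb; rewrite mn -/b; case: b.
Qed.

Lemma degree0_par (A B Y : vectType K) (gA : grading A) (gB : grading B)
    (gY : grading Y) (f : {bilinear A -> B -> Y}) s t x y :
  degree0 gA gB gY f -> par gA s x = x -> par gB t y = y ->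
  par gY (s (+) t) (f x y) = f x y.
Proof.
move=> f0 <- <-.
have -> : par gA s x = \sum_(n <- gdegs gA | odd `|n|%N == s) gpart gA n x by [].
have -> : par gB t y = \sum_(n <- gdegs gB | odd `|n|%N == t) gpart gB n y by [].
rewrite linear_sumlz raddf_sum.
apply: eq_bigr => m /eqP ms; rewrite linear_sumr raddf_sum.
apply: eq_bigr => n /eqP nt.
have mm : homog gA m (gpart gA m x) by rewrite /homog gpartK eqxx.
have nn : homog gB n (gpart gB n y) by rewrite /homog gpartK eqxx.
have := homog_par (f0 _ _ _ _ mm nn); rewrite -ms -nt.
by have -> : odd `|(m + n)%R|%N = odd `|m|%N (+) odd `|n|%N by lia.
Qed.

Lemma par_neq (U : vectType K) (g : grading U) b b' x :
  par g b x = x -> b != b' -> par g b' x = 0.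
Proof. by move=> <- bb'; rewrite parK eq_sym (negPf bb'). Qed.

Lemma par_gprodP (U U' : vectType K) (g : grading U) (g' : grading U') b u :
  par (gprod g g') b u = u <-> par g b u.1 = u.1 /\ par g' b u.2 = u.2.
Proof. by rewrite par_gprod; case: u => x y /=; split=> [[-> ->]|[-> ->]]. Qed.

Lemma sgn_gshift (U : vectType K) (g : grading U) x : sgn (gshift g) x = - sgn g x.
Proof. by rewrite /sgn !par_gshift /= opprB. Qed.

Lemma sgn_gprod (U U' : vectType K) (g : grading U) (g' : grading U') u :
  sgn (gprod g g') u = (sgn g u.1, sgn g' u.2).
Proof. by rewrite /sgn !par_gprod. Qed.

Lemma sgn_homog (U : vectType K) (g : grading U) b x :
  par g b x = x -> sgn g x = (-1) ^+ b *: x.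
Proof. by move=> <-; rewrite sgn_par. Qed.

End ParityOfValues.

(** * The product and the symplectic form of the double semi-direct product *)

Section DoubleProduct.
Variables (K : fieldType) (V M : vectType K) (gV : grading V) (gM : grading M).
Variables (q : {bilinear V -> V -> V}) (l : {bilinear V -> M -> M})
          (r : {bilinear M -> V -> M}).
Hypotheses (q0 : degree0 gV gV gV q) (l0 : degree0 gV gM gM l)
           (r0 : degree0 gM gV gM r).
Local Notation W := (W V M).
Local Notation Wd := (Wd V M).
Local Notation Vt := (Vt V M).
Local Notation gW := (gW gV gM).
Local Notation gWd := (gWd gV gM).
Local Notation gVt1 := (gVt1 gV gM).
Local Notation qW := (qW q l r).
Local Notation lactd := (lactd gV gM q l r).
Local Notation ractd := (ractd q l r).
Local Notation qt := (qt gV gM q l r).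
Local Notation Bt := (Bt gV gM).

Lemma qW_linear_l (w : W) : linear (fun z : W => qW z w).
Proof.
move=> a z z'; rewrite /qW /= !linearPl.
by congr pair; rewrite /= scalerDr addrACA.
Qed.

Lemma qW_linear_r (w : W) : linear (qW w).
Proof.
move=> a z z'; rewrite /qW /= !linearPr.
by congr pair; rewrite /= scalerDr addrACA.
Qed.

Lemma qW_par s t w w' : par gW s w = w -> par gW t w' = w' ->
  par gW (s (+) t) (qW w w') = qW w w'.
Proof.
move=> /par_gprodP[w1 w2] /par_gprodP[w1' w2']; apply/par_gprodP; split=> /=.
  exact: (degree0_par q0).
by rewrite linearD /= (degree0_par l0) ?(degree0_par r0).
Qed.

(** Slides a parity projection from a product onto one factor; [qt_par] uses it to pass a projection
    through the actions on forms, which are defined by transposition. *)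
Lemma qW_par_l s b w w' : par gW s w' = w' ->
  par gW b (qW w w') = qW (par gW (b (+) s) w) w'.
Proof.
move=> w's; pose F c := qW (par gW c w) w'.
have Fp c : par gW (c (+) s) (F c) = F c by apply: qW_par => //; rewrite parK eqxx.
have -> : qW w w' = F (b (+) s) + F (~~ (b (+) s)).
  have qWD x y : qW (x + y) w' = qW x w' + qW y w'.
    by rewrite -[x]scale1r (qW_linear_l w') !scale1r.
  rewrite -[w in LHS](par_sum gW) qWD -/(F _).
  by case: (_ (+) _); rewrite //= addrC.
have := Fp (b (+) s); rewrite -addbA addbb addbF linearD /= => ->.
rewrite (par_neq (Fp _)) ?addr0 //.
by case: b; case: s {w's Fp F}.
Qed.

Lemma qW_par_r s b w w' : par gW s w = w ->
  par gW b (qW w w') = qW w (par gW (b (+) s) w').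
Proof.
move=> ws; pose F c := qW w (par gW c w').
have Fp c : par gW (s (+) c) (F c) = F c by apply: qW_par => //; rewrite parK eqxx.
have -> : qW w w' = F (b (+) s) + F (~~ (b (+) s)).
  have qWD x y : qW w (x + y) = qW w x + qW w y.
    by rewrite -[x]scale1r (qW_linear_r w) !scale1r.
  rewrite -[w' in LHS](par_sum gW) qWD -/(F _).
  by case: (_ (+) _); rewrite //= addrC.
have := Fp (b (+) s); rewrite addbC -addbA addbb addbF linearD /= => ->.
rewrite (par_neq (Fp _)) ?addr0 //.
by case: b; case: s {ws Fp F}.
Qed.

Lemma ev0r (f : Wd) : ev f 0 = 0. Proof. by rewrite /ev !linear0 addr0. Qed.
Lemma ev0l (w : W) : ev 0 w = 0. Proof. by rewrite /ev !lfunE addr0. Qed.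
Lemma evDl (f f' : Wd) w : ev (f + f') w = ev f w + ev f' w.
Proof. by rewrite -[f]scale1r (ev_linear_l w) !scale1r. Qed.
Lemma evDr (f : Wd) w w' : ev f (w + w') = ev f w + ev f w'.
Proof. by rewrite -[w]scale1r (ev_linear_r f) !scale1r. Qed.
Lemma evZr (f : Wd) a w : ev f (a *: w) = a * ev f w.
Proof. by rewrite -[a *: w]addr0 (ev_linear_r f) ev0r addr0. Qed.
Lemma evZl (f : Wd) a w : ev (a *: f) w = a * ev f w.
Proof. by rewrite -[a *: f]addr0 (ev_linear_l w) ev0l addr0. Qed.
Lemma evNr (f : Wd) w : ev f (- w) = - ev f w.
Proof. by rewrite -scaleN1r evZr mulN1r. Qed.
Lemma evNl (f : Wd) w : ev (- f) w = - ev f w.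
Proof. by rewrite -scaleN1r evZl mulN1r. Qed.

Lemma ev_inj (f f' : Wd) : ev f =1 ev f' -> f = f'.
Proof.
move=> ff; apply/eqP; rewrite -subr_eq0; apply/eqP/ev_nondeg_l => w.
by rewrite evDl evNl ff subrr.
Qed.

Lemma ev_sgn f w : ev (sgn gWd f) w = ev f (sgn gW w).
Proof. by rewrite /sgn !evDl !evNl !evDr !evNr !ev_par. Qed.

Lemma ev_form_of (phi : W -> K^o) w : linear phi -> ev (form_of phi) w = phi w.
Proof.
move=> phiP; rewrite /ev /form_of /=.
have phi1 : linear (fun x : V => phi (x, 0)).
  by move=> a x y; rewrite -phiP; congr phi; congr pair; rewrite /= scaler0 addr0.
have phi2 : linear (fun x : M => phi (0, x)).
  by move=> a x y; rewrite -phiP; congr phi; congr pair; rewrite /= scaler0 addr0.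
pose L1 : {linear V -> K^o} := HB.pack (fun x : V => phi (x, 0))
  (GRing.isLinear.Build K V K^o *:%R _ phi1).
pose L2 : {linear M -> K^o} := HB.pack (fun x : M => phi (0, x))
  (GRing.isLinear.Build K M K^o *:%R _ phi2).
rewrite (lfunE L1) (lfunE L2) /= -[phi (w.1, 0)]scale1r -phiP.
by case: w => x y; congr phi; congr pair; rewrite /= ?scale1r ?addr0 ?add0r.
Qed.

Lemma ev_ractd f w z : ev (ractd f w) z = ev f (qW w z).
Proof.
by apply: ev_form_of => a x y; rewrite (qW_linear_r w) (ev_linear_r f).
Qed.

(** A term of the triple sum is nonzero only for s = t (+) p, and then its sign exponent p && (s (+)
    t) is p; summing over p gives [sgn] of w. *)
Lemma ev_lactd f w z : ev (lactd w f) z = ev f (qW z (sgn gW w)).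
Proof.
rewrite /Defs.lactd; set phi := (X in form_of X).
have E x : phi x = ev f (qW x (sgn gW w)).
  have evp s t p : ev (par gWd s f) (qW (par gW t x) (par gW p w)) =
      if s == t (+) p then ev f (qW (par gW t x) (par gW p w)) else 0.
    have tp : par gW (t (+) p) (qW (par gW t x) (par gW p w)) =
        qW (par gW t x) (par gW p w) by apply: qW_par; rewrite parK eqxx.
    rewrite ev_par; case: eqP => [->|/eqP st]; first by rewrite tp.
    by rewrite (par_neq tp) ?ev0r // eq_sym.
  have qWD y y' u u' : qW (y + y') (u - u') = qW y u + qW y' u - (qW y u' + qW y' u').
    rewrite -[y in LHS]scale1r (qW_linear_l (u - u')) scale1r.
    rewrite -scaleN1r (addrC u) !(qW_linear_r _ (-1)).
    by rewrite addrACA -scalerDr addrC scaleN1r.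
  rewrite -{2}[x](par_sum gW) {}/sgn qWD !(evDr, evNr).
  rewrite /phi !big_bool /= !evp /= !(expr0, expr1).
  by ring.
apply: etrans (E z); apply: ev_form_of => a x y; rewrite !E.
by rewrite (qW_linear_l (sgn gW w)) (ev_linear_r f).
Qed.

Lemma ev_qt2 u v z : ev (qt u v).2 z =
  ev v.2 (qW z (sgn gW u.1)) + ev u.2 (qW v.1 z).
Proof. by rewrite /qt evDl ev_lactd ev_ractd. Qed.

Lemma qt0l v : qt 0 v = 0.
Proof.
have q0l z : qW 0 z = 0 by rewrite /Defs.qW /= !linear0l addr0.
have q0r z : qW z 0 = 0 by rewrite /Defs.qW /= !linear0r addr0.
rewrite [LHS]surjective_pairing; congr pair; first by rewrite /= q0l.
by apply: ev_inj => z; rewrite ev_qt2 /= linear0 q0r ev0r !ev0l addr0.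
Qed.

Lemma qt0r u : qt u 0 = 0.
Proof.
have q0l z : qW 0 z = 0 by rewrite /Defs.qW /= !linear0l addr0.
have q0r z : qW z 0 = 0 by rewrite /Defs.qW /= !linear0r addr0.
rewrite [LHS]surjective_pairing; congr pair; first by rewrite /= q0r.
by apply: ev_inj => z; rewrite ev_qt2 /= q0l ev0r !ev0l addr0.
Qed.

Lemma qt_par s t u v : par (gVt gV gM) s u = u -> par (gVt gV gM) t v = v ->
  par (gVt gV gM) (s (+) t) (qt u v) = qt u v.
Proof.
move=> /par_gprodP[u1 u2] /par_gprodP[v1 v2]; apply/par_gprodP; split=> /=.
  exact: qW_par.
have us : par gW s (sgn gW u.1) = sgn gW u.1.
  by rewrite -[in RHS]u1 sgn_par par_sgn.
apply: ev_inj => z; rewrite ev_par -/(qt u v).2 !ev_qt2; congr (_ + _).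
  by rewrite -[in RHS]v2 [RHS]ev_par (qW_par_l _ _ us) (addbC t).
by rewrite -[in RHS]u2 [RHS]ev_par (qW_par_r _ _ v1).
Qed.

Lemma sgn_gVt1 (u : Vt) : sgn gVt1 u = - (sgn gW u.1, sgn gWd u.2).
Proof. by rewrite sgn_gshift sgn_gprod. Qed.

Lemma shift2_qt_par s t u v : par gVt1 s u = u -> par gVt1 t v = v ->
  par gVt1 (~~ (s (+) t)) (shift2 gVt1 qt u v) = shift2 gVt1 qt u v.
Proof.
have -> : s (+) t = ~~ s (+) ~~ t by case: s; case: t.
rewrite !par_gshift negbK => us vt.
apply: qt_par => //.
by rewrite sgn_gshift linearN /= par_sgn us (sgn_homog us).
Qed.

Lemma BtE u v : Bt u v = - (ev u.2 (sgn gW v.1) + ev v.2 u.1).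
Proof.
rewrite /Defs.Bt bt_sgn sgn_gVt1 /= linearN /= sgnK evNl evNr ev_sgn.
exact/esym/opprD.
Qed.

(** This is graded antisymmetry: [Bt] pairs only vectors of equal parity, so the Koszul sign of
    exchanging u and v is the sign of v alone. *)
Lemma Bt_swap u v : Bt u v = - Bt (sgn gVt1 v) u.
Proof.
rewrite !BtE sgn_gVt1 /= evNl evNr ev_sgn sgnK opprK.
by rewrite addrC opprD.
Qed.

Lemma Bt_par b u v : Bt (par gVt1 b u) v = Bt u (par gVt1 b v).
Proof. by rewrite /Defs.Bt -bt_par par_sgn sgn_par. Qed.

(** The two summands are transposes of the right and the left action on M. With a a value of C they
    give the two outer terms of the Hochschild coboundary. *)
Lemma shift2_qt_form u v a : - (shift2 gVt1 qt u v).2.2 a =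
  v.2.2 (r a u.1.1) - (sgn gVt1 u).2.2 (l v.1.1 a).
Proof.
have ev2 (f : Wd) : f.2 a = ev f (0, a) by rewrite /ev linear0 add0r.
rewrite ev2 ev_qt2 [in X in X + _]sgn_gVt1 /= linearN /= sgnK.
rewrite {1 2}/ev /Defs.qW /= !linear0l !linear0r !linear0 !add0r.
by rewrite addr0 linearN /= linearN opprD opprK.
Qed.

End DoubleProduct.

Section TuplesOfArguments.
Variable T : Type.

Lemma ff_init_snoc n (u : (T ^ n)%type) x : ff_init (ff_snoc u x) = u.
Proof. by apply/ffunP => i; rewrite !ffunE liftK. Qed.

Lemma ff_snoc_max n (u : (T ^ n)%type) x : ff_snoc u x ord_max = x.
Proof. by rewrite ffunE unlift_none. Qed.

End TuplesOfArguments.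

Lemma tot_recr n (p : {ffun 'I_n.+1 -> bool}) : tot p = tot (ff_init p) (+) p ord_max.
Proof.
rewrite /tot big_ord_recr /=; congr addb; apply: eq_bigr => i _; rewrite ffunE.
by congr (p _); apply/val_inj; rewrite /= /bump leqNgt ltn_ord.
Qed.

Lemma tot_recl n (p : {ffun 'I_n.+1 -> bool}) : tot p = p ord0 (+) tot (ff_tail p).
Proof.
by rewrite /tot big_ord_recl; congr addb; apply: eq_bigr => i _; rewrite ffunE.
Qed.

Lemma tot_merge n (i : 'I_n) (p : {ffun 'I_n.+1 -> bool}) :
  tot (ff_merge (fun a b => ~~ (a (+) b)) i p) = ~~ tot p.
Proof.
(* The merged slot i gets both conditionals and the extra unit j == i, which stands for the odd
   degree of the product; the three parts can then be summed separately. *)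
have E (j : 'I_n) : ff_merge (fun a b => ~~ (a (+) b)) i p j =
    (if (j <= i)%N then p (lift ord_max j) else false) (+)
    (if (i <= j)%N then p (lift ord0 j) else false) (+) (j == i).
  rewrite ffunE; case: (ltngtP j i) => [ji|ji|/val_inj ->].
  - by rewrite -(inj_eq val_inj) (ltn_eqF ji) !addbF.
  - by rewrite -(inj_eq val_inj) (gtn_eqF ji) addbF.
  by rewrite eqxx; case: (p _); case: (p _).
rewrite /tot (eq_bigr _ (fun j _ => E j)) !big_split /=.
have -> : \big[addb/false]_(j < n) (j == i) = true.
  by rewrite (bigD1 i) //= eqxx big1 // => j /negPf.
have -> : \big[addb/false]_(j < n) (if (j <= i)%N then p (lift ord_max j) else false)
    = \big[addb/false]_(j < n.+1) (if (j <= i)%N then p j else false).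
  rewrite big_ord_recr /= leqNgt ltn_ord addbF; apply: eq_bigr => j _.
  by congr (if _ then p _ else _); apply/val_inj; rewrite /= /bump leqNgt ltn_ord.
have -> : \big[addb/false]_(j < n) (if (i <= j)%N then p (lift ord0 j) else false)
    = \big[addb/false]_(j < n.+1) (if (i < j)%N then p j else false).
  by rewrite big_ord_recl.
rewrite addbT; congr negb; rewrite -big_split; apply: eq_bigr => j _ /=.
by case: ltnP; rewrite ?addbF.
Qed.

(** * Truncation and merging of argument tuples *)

Section SlotLemmas.
Variables (K : fieldType) (U : vectType K) (g : grading U).

Lemma slotcomb_init n (i : 'I_n) a (u v w : (U ^ n.+1)%type) :
  slotcomb (lift ord_max i) a u v w ->
  slotcomb i a (ff_init u) (ff_init v) (ff_init w) /\
  (u ord_max = w ord_max /\ v ord_max = w ord_max).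
Proof.
case=> wi wj; split; last by apply: wj; rewrite eq_sym eq_sym neq_lift.
split=> [|j ji]; rewrite !ffunE //.
by apply: wj; rewrite (inj_eq lift_inj).
Qed.

Lemma slotcomb_last n a (u v w : (U ^ n.+1)%type) :
  slotcomb ord_max a u v w ->
  w ord_max = a *: u ord_max + v ord_max /\
  (ff_init u = ff_init w /\ ff_init v = ff_init w).
Proof.
case=> wi wj; split=> //.
by split; apply/ffunP => j; rewrite !ffunE; have [] := wj (lift ord_max j);
  rewrite // eq_sym neq_lift.
Qed.

Lemma slotcomb_tail n (i : 'I_n) a (u v w : (U ^ n.+1)%type) :
  slotcomb (lift ord0 i) a u v w ->
  slotcomb i a (ff_tail u) (ff_tail v) (ff_tail w) /\
  (u ord0 = w ord0 /\ v ord0 = w ord0).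
Proof.
case=> wi wj; split; last exact: wj.
split=> [|j ji]; rewrite !ffunE //.
by apply: wj; rewrite (inj_eq lift_inj).
Qed.

Lemma slotcomb_first n a (u v w : (U ^ n.+1)%type) :
  slotcomb ord0 a u v w ->
  w ord0 = a *: u ord0 + v ord0 /\
  (ff_tail u = ff_tail w /\ ff_tail v = ff_tail w).
Proof.
case=> wi wj; split=> //.
by split; apply/ffunP => j; rewrite !ffunE; have [] := wj (lift ord0 j).
Qed.

(** The slot t is s when s <= i and s - 1 otherwise. Slots i and i + 1 both land in slot i, where
    linearity of m in its first or second argument is used. *)
Lemma slotcomb_merge n (m : U -> U -> U) (i : 'I_n) (s : 'I_n.+1) a
    (u v w : (U ^ n.+1)%type) :
  (forall y, linear (m^~ y)) -> (forall x, linear (m x)) ->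
  slotcomb s a u v w ->
  exists t, slotcomb t a (ff_merge m i u) (ff_merge m i v) (ff_merge m i w).
Proof.
move=> mPl mPr [ws wj].
have liftm (j : 'I_n) : lift ord_max j = j :> nat.
  by rewrite /= /bump leqNgt ltn_ord.
have lift0 (j : 'I_n) : lift ord0 j = j.+1 :> nat by [].
have neq (j : 'I_n.+1) : j != s :> nat -> u j = w j /\ v j = w j.
  by rewrite (inj_eq val_inj); apply: wj.
have eqs (j : 'I_n.+1) : j = s :> nat -> w j = a *: u j + v j.
  by move/val_inj ->.
have [si|si] := leqP s i.
  have sn : (s < n)%N by apply: leq_ltn_trans si (ltn_ord i).
  exists (Ordinal sn); split=> [|j]; rewrite !ffunE -?(inj_eq val_inj) /=.
    case: ltngtP si => //= [si _|si _]; first by apply: eqs; rewrite liftm.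
    rewrite (eqs (lift ord_max i)) ?liftm //.
    have [|-> ->] := neq (lift ord0 i); rewrite ?lift0; first by lia.
    exact: mPl.
  move=> js; case: ltngtP => ji /=.
  - by apply: neq; rewrite liftm.
  - by apply: neq; rewrite lift0; lia.
  have [|-> ->] := neq (lift ord0 i); rewrite ?lift0; first by lia.
  by have [|-> ->] := neq (lift ord_max i); rewrite ?liftm -?ji.
have sn : (s.-1 < n)%N by have := ltn_ord s; lia.
exists (Ordinal sn); split=> [|j]; rewrite !ffunE -?(inj_eq val_inj) /=.
  case: ltngtP => //= [|is1|is1]; first lia.
    by apply: eqs; rewrite lift0 /=; lia.
  rewrite (eqs (lift ord0 i)) ?lift0; last by lia.
  have [|-> ->] := neq (lift ord_max i); rewrite ?liftm; first by lia.
  exact: mPr.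
move=> js; case: ltngtP => ji /=.
- by apply: neq; rewrite liftm; lia.
- by apply: neq; rewrite lift0; lia.
have [|-> ->] := neq (lift ord0 i); rewrite ?lift0; first by lia.
by have [|-> ->] := neq (lift ord_max i); rewrite ?liftm; first by lia.
Qed.

Lemma phomog_init n (p : {ffun 'I_n.+1 -> bool}) (u : (U ^ n.+1)%type) :
  phomog g p u -> phomog g (ff_init p) (ff_init u).
Proof. by move=> pu i; rewrite !ffunE pu. Qed.

Lemma phomog_tail n (p : {ffun 'I_n.+1 -> bool}) (u : (U ^ n.+1)%type) :
  phomog g p u -> phomog g (ff_tail p) (ff_tail u).
Proof. by move=> pu i; rewrite !ffunE pu. Qed.

Lemma phomog_merge n (m : U -> U -> U) f (i : 'I_n) (p : {ffun 'I_n.+1 -> bool})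
    (u : (U ^ n.+1)%type) :
  (forall b c x y, par g b x = x -> par g c y = y ->
     par g (f b c) (m x y) = m x y) ->
  phomog g p u -> phomog g (ff_merge f i p) (ff_merge m i u).
Proof.
move=> mP pu j; rewrite !ffunE; case: (_ < _)%N; first exact: pu.
by case: (_ == _); [apply: mP; apply: pu|apply: pu].
Qed.

End SlotLemmas.

(** * Forms attached to maps from V to M, and the contraction with an odd product *)

Section ExtensionByZero.
Variables (K : fieldType) (V M : vectType K) (gV : grading V) (gM : grading M).
Local Notation Vt := (Vt V M).
Local Notation gV1 := (gV1 gV).
Local Notation gM1 := (gM1 gM).
Local Notation gVt1 := (gVt1 gV gM).
Local Notation Bt := (Bt gV gM).
Local Notation Omega := (Omega gV gM).

Definition base n (u : (Vt ^ n)%type) : (V ^ n)%type := [ffun i => (u i).1.1].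

(** Parities are those of the shifted gradings: [true] is for C, of degree 1, and [false] for its
    coboundary, of degree 2. *)
Definition has_parity n (b : bool) (D : (V ^ n)%type -> M) : Prop :=
  forall p x, phomog gV1 p x -> par gM1 (tot p (+) b) (D x) = D x.

Lemma Omega_ext0E n (D : (V ^ n)%type -> M) v :
  Omega (ext0 D) v = - (v ord_max).2.2 (D (base (ff_init v))).
Proof.
by rewrite /Defs.Omega BtE ev0l add0r /ev /= linear0 add0r.
Qed.

Lemma phomog_base n p (v : (Vt ^ n)%type) :
  phomog gVt1 p v -> phomog gV1 p (base v).
Proof.
move=> pv i; rewrite ffunE; have := pv i.
by rewrite !par_gshift => /par_gprodP[/par_gprodP[]].
Qed.

Lemma par_gVt1_form b (v : Vt) a : par gVt1 b v = v -> v.2.2 (par gM1 b a) = v.2.2 a.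
Proof.
rewrite !par_gshift => /par_gprodP[_ /par_gprodP[_ v2]].
by rewrite -par_gdual v2.
Qed.

Lemma slotcomb_base n (i : 'I_n) a (u v w : (Vt ^ n)%type) :
  slotcomb i a u v w -> slotcomb i a (base u) (base v) (base w).
Proof.
case=> wi wj; split=> [|j ji]; rewrite !ffunE; first by rewrite wi.
by have [-> ->] := wj _ ji.
Qed.

Lemma multilinear_Omega_ext0 n (D : (V ^ n)%type -> M) :
  multilinear D -> multilinear (Omega (ext0 D)).
Proof.
move=> /multilinearP DP; apply/multilinearP => i a u v w uvw.
rewrite !Omega_ext0E; case: (unliftP ord_max i) => [j|] ij; rewrite ij in uvw.
  have [/slotcomb_base/DP -> [-> ->]] := slotcomb_init uvw.
  by rewrite linearP opprD scalerN.
have [-> [-> ->]] := slotcomb_last uvw.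
by rewrite /= add_lfunE scale_lfunE opprD scalerN.
Qed.

(** The last argument is paired with a value of D of parity [tot (ff_init p) (+) b], and the pairing
    of M with its dual vanishes unless this is the parity of the last argument. *)
Lemma Omega_ext0_eq0 n b (D : (V ^ n)%type -> M) p v :
  has_parity b D -> phomog gVt1 p v -> tot p != b -> Omega (ext0 D) v = 0.
Proof.
move=> Db pv pb; rewrite Omega_ext0E -(par_gVt1_form _ (pv ord_max)).
have /Db Dp := phomog_base (phomog_init pv).
rewrite (par_neq Dp) ?linear0 ?oppr0 //.
by move: pb; rewrite tot_recr; case: tot; case: (p _); case: b {Db Dp}.
Qed.

Lemma Bt0l v : Bt 0 v = 0.
Proof.
have := Bt_linear_l gV gM v (-1) 0 0.
by rewrite scaler0 addr0 scaleN1r addNr.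
Qed.

Lemma Bt0r v : Bt v 0 = 0.
Proof. by rewrite Bt_swap linear0 Bt0l oppr0. Qed.

(** Nondegeneracy of [Bt] characterizes the map, so the inverse in [map_of_form] never has to be
    unfolded. *)
Lemma eq_map_of_form k (Om : (Vt ^ k.+1)%type -> K^o) u x :
  multilinear Om -> (forall v, Bt x v = Om (ff_snoc u v)) ->
  map_of_form gV gM Om u = x.
Proof.
move=> OmP xP; apply/eqP; rewrite -subr_eq0; apply/eqP/(Bt_nondeg (gV := gV) (gM := gM)).
move=> v; rewrite addrC -scaleN1r (Bt_linear_l gV gM v) xP -(Omega_map_of_form gV gM OmP).
by rewrite /Defs.Omega ff_init_snoc ff_snoc_max scaleN1r addNr.
Qed.

Lemma Bt_map_of_form k (Om : (Vt ^ k.+1)%type -> K^o) u v :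
  multilinear Om -> Bt (map_of_form gV gM Om u) v = Om (ff_snoc u v).
Proof.
move=> OmP; rewrite -(Omega_map_of_form gV gM OmP).
by rewrite /Defs.Omega ff_init_snoc ff_snoc_max.
Qed.

Lemma slotcomb_snoc n (i : 'I_n) a (u v w : (Vt ^ n)%type) x :
  slotcomb i a u v w ->
  slotcomb (lift ord_max i) a (ff_snoc u x) (ff_snoc v x) (ff_snoc w x).
Proof.
case=> wi wj; split=> [|j]; rewrite !ffunE ?liftK //.
by case: unliftP => [j' ->|//]; rewrite (inj_eq lift_inj) => /wj.
Qed.

Lemma multilinear_map_of_form k (Om : (Vt ^ k.+1)%type -> K^o) :
  multilinear Om -> multilinear (map_of_form gV gM Om).
Proof.
move=> OmP; have /multilinearP OmS := OmP.
apply/multilinearP => i a u v w uvw; apply: eq_map_of_form => // x.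
rewrite (Bt_linear_l gV gM x) !Bt_map_of_form //; apply/esym.
by apply: OmS; apply: slotcomb_snoc uvw.
Qed.

Lemma multilinear_cycl_ext0 n (D : (V ^ n)%type -> M) :
  multilinear D -> multilinear (cycl gVt1 (Omega (ext0 D))).
Proof. by move=> DP; apply/multilinear_cycl/multilinear_Omega_ext0. Qed.

Lemma Omega_tilde n (D : (V ^ n)%type -> M) : multilinear D ->
  Omega (tilde gV gM D) =1 cycl gVt1 (Omega (ext0 D)).
Proof. by move=> DP; apply: Omega_map_of_form; apply: multilinear_cycl_ext0. Qed.

Lemma quadratic_tilde n (D : (V ^ n)%type -> M) : multilinear D ->
  quadratic gV gM (tilde gV gM D).
Proof.
move=> DP; have OmP := multilinear_Omega_ext0 DP.
split; first exact/multilinear_map_of_form/multilinear_cycl_ext0.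
split=> [|s sc u].
  by apply: eq_multilinear (multilinear_cycl_ext0 DP) => u; rewrite Omega_tilde.
rewrite Omega_tilde // -(perm_form_cycl gVt1 OmP sc); apply: eq_perm_form => p v _.
exact: Omega_tilde.
Qed.

Lemma Bt_tilde n (D : (V ^ n)%type -> M) u v : multilinear D ->
  Bt (tilde gV gM D u) v = cycl gVt1 (Omega (ext0 D)) (ff_snoc u v).
Proof. by move=> DP; apply: Bt_map_of_form; apply: multilinear_cycl_ext0. Qed.

Lemma tilde_linear n a (D D' D'' : (V ^ n)%type -> M) :
  multilinear D -> multilinear D' -> (D'' =1 fun x => a *: D x + D' x) ->
  forall u, tilde gV gM D'' u = a *: tilde gV gM D u + tilde gV gM D' u.
Proof.
move=> DP D'P DE u.
have D''P : multilinear D''.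
  by apply: eq_multilinear (multilinear_comb a DP D'P) => x; rewrite DE.
apply: eq_map_of_form => [|v]; first exact: multilinear_cycl_ext0.
apply: etrans (Bt_linear_l gV gM v _ _ _) _.
apply: etrans (congr2 (fun s t : K^o => a *: s + t) (Bt_tilde u v DP)
                 (Bt_tilde u v D'P)) _.
rewrite /cycl scaler_sumr -big_split /=; apply: eq_bigr => s _; rewrite /perm_form /by_parity scaler_sumr -big_split /=.
apply: eq_bigr => p _; rewrite !Omega_ext0E DE linearP.
by rewrite scalerAr -mulrDr scalerN opprD.
Qed.

(** The sum over dual bases becomes [Bt] of Q and R w. The Koszul sign of moving R past the two
    arguments of the product is (-1)^s, with s their joint parity, because R is odd. Exchanging Q,
    of parity ~~ s, with R w costs (-1)^s again, so no sign is left. *)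
Lemma contraction_homog N (e e' : N.-tuple Vt) k (q : Vt -> Vt -> Vt)
    (R : (Vt ^ k)%type -> Vt) :
  basis_of fullv e -> (forall i j : 'I_N, bt gV gM e`_i e'`_j = (i == j)%:R) ->
  (forall s t u v, par gVt1 s u = u -> par gVt1 t v = v ->
     par gVt1 (~~ (s (+) t)) (q u v) = q u v) ->
  (forall u, q u 0 = 0) -> (forall u, q 0 u = 0) -> multilinear R ->
  (forall p v, phomog gVt1 p v -> ~~ tot p -> Omega R v = 0) ->
  forall (p : {ffun 'I_(2 + k) -> bool}) u, phomog gVt1 p u ->
  contraction gV gM e e' (Omega (fun v : (Vt ^ 2)%type => q (v ord0) (v ord_max)))
    (Omega R) u =
  Omega R (ff_snoc [ffun j => u (rshift 2 j)] (q (u ord0) (u (lift ord0 ord0)))).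
Proof.
move=> be de qpar q0r q0l RP Rodd p u pu.
rewrite (contraction_Omega be de).
have shiftE (v : (Vt ^ (2 + k))%type) :
    ([ffun j => v (lshift k j)] : (Vt ^ 2)%type) ord0 = v ord0 /\
    ([ffun j => v (lshift k j)] : (Vt ^ 2)%type) ord_max = v (lift ord0 ord0).
  by rewrite !ffunE; split; congr (v _); apply/val_inj.
rewrite (by_parity_homog _ pu) => [|p' v i vi]; last first.
  apply: big1 => b _; have [-> ->] := shiftE v.
  case: (split_ordP i) vi => [j ->|j ->] vi.
    suff -> : q (v ord0) (v (lift ord0 ord0)) = 0.
      by rewrite Bt0l mulr0.
    case: j vi => [[|[|//]] j2] vi.
      by rewrite -[v ord0]/(v _) (_ : ord0 = lshift k (Ordinal j2)) ?vi ?q0l //; apply/val_inj.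
    by rewrite (_ : lift ord0 ord0 = lshift k (Ordinal j2)) ?vi ?q0r //; apply/val_inj.
  rewrite (multilinear0 (i := j) RP) ?ffunE // linear0.
  by rewrite Bt0r mulr0.
have [-> ->] := shiftE u.
set Q := q _ _; set s := p ord0 (+) p (lift ord0 ord0).
set w := [ffun j => _] : (Vt ^ k)%type.
have Qs : par gVt1 (~~ s) Q = Q by apply: qpar.
have -> : \big[addb/false]_(j < 2) p (lshift k j) = s.
  rewrite !big_ord_recl big_ord0 addbF; congr (p _ (+) p _); exact/val_inj.
have pw : phomog gVt1 [ffun j => p (rshift 2 j)] w.
  by move=> j; rewrite !ffunE pu.
set P := \big[addb/false]_(j < k) _.
(* Only the component of R w with the parity of Q contributes. *)
have BR b : Bt Q (par gVt1 b (R w)) =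
    if b == ~~ s then (-1) ^+ s * Bt (R w) Q else 0.
  have -> : Bt (R w) Q = (-1) ^+ s * Bt Q (R w).
    rewrite Bt_swap (sgn_homog Qs) -[_ *: Q]addr0 (Bt_linear_l gV gM (R w)) Bt0l addr0.
    by rewrite signrN scaleNr opprK.
  rewrite mulrA -signr_addb addbb mul1r -Bt_par; case: eqP => [->|/eqP bs].
    by rewrite Qs.
  by rewrite (par_neq Qs) ?Bt0l // eq_sym.
have -> : Omega R (ff_snoc w Q) = Bt (R w) Q.
  by rewrite /Defs.Omega ff_init_snoc ff_snoc_max.
rewrite big_bool /= !BR.
(* Otherwise w followed by Q has even total parity, where the form of R vanishes; this forces P (+)
   b to be true in the surviving term. *)
have : ~~ (P (+) ~~ s) -> Bt (R w) Q = 0.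
  move=> Ps; rewrite -(Rodd (ff_snoc [ffun j => p (rshift 2 j)] (~~ s)) (ff_snoc w Q)).
  - by rewrite /Defs.Omega ff_init_snoc ff_snoc_max.
  - by move=> i; rewrite !ffunE; case: unliftP.
  rewrite tot_recr ff_init_snoc ff_snoc_max; congr (~~ (_ (+) _)): Ps.
  by apply: eq_bigr => j _; rewrite ffunE.
by case: s {BR Qs}; [case: P => /= [_|/(_ isT) ->] | case: P => /= [/(_ isT) ->|_]];
  rewrite ?mulr0 ?addr0 ?add0r ?mul1r // !expr1 !mulN1r opprK.
Qed.

End ExtensionByZero.

(** * Parity of cochains and the pieces of the Hochschild coboundary *)

Section Cochains.
Variables (K : fieldType) (V M : vectType K) (gV : grading V) (gM : grading M).
Local Notation gV1 := (gV1 gV).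
Local Notation gM1 := (gM1 gM).

(** Modulo 2 the degree is the sum of the shifted degrees d i - 1. *)
Lemma odd_sum_abs k (d : 'I_k -> int) :
  odd `|(\sum_i d i + (2 - k%:Z))%R|%N = \big[addb/false]_(i < k) ~~ odd `|d i|%N.
Proof.
elim: k d => [|k IHk] d; first by rewrite !big_ord0.
rewrite !big_ord_recr /= -IHk; set s := \sum_(i < k) _; lia.
Qed.

(** A value of unshifted parity [tot p] has the opposite parity in M[1]. Since [cochain] speaks of
    integer degrees, the component of c of the wrong parity is shown to vanish after splitting each
    argument into integer degrees. *)
Lemma cochain_parity k (c : (V ^ k)%type -> M) :
  cochain gV gM c -> has_parity gV gM true c.
Proof.
case=> cP cdeg p x px; rewrite addbT.
rewrite -[RHS](par_sum gM1).
have c0 : par gM1 (tot p) (c x) = 0.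
  apply: (multilinear_vanish (h := fun v => par gM1 (tot p) (c v))
    (S := fun i y => exists2 n, odd `|n|%N = ~~ p i & homog gV n y)) => [|v vS|i].
  - apply: linear_multilinear cP; exact: par_is_linear.
  - have /fin_all_exists[d dP] (i : 'I_k) :
        exists n, odd `|n|%N = ~~ p i /\ homog gV n (v i).
      by have [n] := vS i; exists n.
    have := homog_par (cdeg d v (fun i => (dP i).2)).
    rewrite odd_sum_abs par_gshift => cv; apply: par_neq cv _.
    under eq_bigr => i _ do rewrite (dP i).1 negbK.
    by rewrite -/(tot p); case: tot.
  exists [seq gpart gV n (x i) | n <- gdegs gV & odd `|n|%N == ~~ p i].
    by rewrite -[x i in LHS]px par_gshift /par big_map big_filter.
  move=> y /mapP[n]; rewrite mem_filter => /andP[/eqP np _] ->.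
  by exists n => //; rewrite /homog gpartK eqxx.
by move: c0; case: tot => /= ->; rewrite ?addr0 ?add0r.
Qed.

Lemma multilinear_shiftmap k (c : (V ^ k)%type -> M) :
  multilinear c -> multilinear (shiftmap gV1 c).
Proof. by move=> cP; apply: multilinear_by_parity => p; apply: multilinearZ. Qed.

Lemma shiftmap_parity b k (c : (V ^ k)%type -> M) :
  multilinear c -> has_parity gV gM b c -> has_parity gV gM b (shiftmap gV1 c).
Proof.
move=> cP cb p x px.
have -> : shiftmap gV1 c x = (-1) ^+ (\sum_(j < k) (k - j.+1) * p j)%N *: c x.
  apply: (by_parity_multilinear (F := fun p x => _)) px => {}p.
  exact: multilinearZ.
by rewrite linearZ /= cb.
Qed.

Section Coboundary.
Variables (q : {bilinear V -> V -> V}) (l : {bilinear V -> M -> M})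
          (r : {bilinear M -> V -> M}).
Hypotheses (q0 : degree0 gV gV gV q) (l0 : degree0 gV gM gM l)
           (r0 : degree0 gM gV gM r).
Variables (k : nat) (C : (V ^ k)%type -> M).
Hypotheses (CP : multilinear C) (Codd : has_parity gV gM true C).

(* The sign (-1)^(deg x_0) in dH cancels the one hidden in Q (x_0, .), so that
   dH_left carries no sign; the sign of dH_merge is added in dH_inner. *)
Definition dH_left (x : (V ^ k.+1)%type) : M := l (x ord0) (C (ff_tail x)).
Definition dH_right (x : (V ^ k.+1)%type) : M :=
  shift2 gM1 r (C (ff_init x)) (x ord_max).
Definition dH_merge (i : 'I_k) (x : (V ^ k.+1)%type) : M :=
  C (ff_merge (shift2 gV1 q) i x).

Definition dH_inner (i : 'I_k) : (V ^ k.+1)%type -> M :=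
  by_parity gV1 (fun p x =>
    (-1) ^+ (\big[addb/false]_(j < k.+1 | (j < i)%N) p j) *: dH_merge i x).

Lemma shift2q_linear_l y : linear ((shift2 gV1 q)^~ y).
Proof. by move=> a x x'; rewrite /shift2 linearP linearPl. Qed.

Lemma shift2q_linear_r x : linear (shift2 gV1 q x).
Proof. by move=> a y y'; rewrite /shift2 linearPr. Qed.

Lemma multilinear_dH_left : multilinear dH_left.
Proof.
have /multilinearP CS := CP.
apply/multilinearP => i a u v w uvw; rewrite /dH_left.
case: (unliftP ord0 i) => [j|] ij; rewrite ij in uvw.
  by have [/CS -> [-> ->]] := slotcomb_tail uvw; rewrite linearPr.
by have [-> [-> ->]] := slotcomb_first uvw; rewrite linearPl.
Qed.

Lemma multilinear_dH_right : multilinear dH_right.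
Proof.
have /multilinearP CS := CP.
apply/multilinearP => i a u v w uvw; rewrite /dH_right /shift2.
case: (unliftP ord_max i) => [j|] ij; rewrite ij in uvw.
  by have [/CS -> [-> ->]] := slotcomb_init uvw; rewrite linearP linearPl.
by have [-> [-> ->]] := slotcomb_last uvw; rewrite linearPr.
Qed.

Lemma multilinear_dH_merge i : multilinear (dH_merge i).
Proof.
have /multilinearP CS := CP.
apply/multilinearP => s a u v w uvw.
have [t] := slotcomb_merge i shift2q_linear_l shift2q_linear_r uvw.
exact: CS.
Qed.

Lemma multilinear_dH_inner i : multilinear (dH_inner i).
Proof.
by apply: multilinear_by_parity => p; apply/multilinearZ/multilinear_dH_merge.
Qed.

Lemma dH_inner_homog i p x : phomog gV1 p x -> dH_inner i x =
  (-1) ^+ (\big[addb/false]_(j < k.+1 | (j < i)%N) p j) *: dH_merge i x.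
Proof.
move=> px; apply: (by_parity_multilinear (F := fun p x => _)) px => {}p.
exact/multilinearZ/multilinear_dH_merge.
Qed.

(** The summands are separated because each will be matched after a different rotation, so each
    needs a multilinear form of its own. *)
Lemma dHE : dH gV gM q l r C =1
  fun x => dH_left x + dH_right x + \sum_(i < k) dH_inner i x.
Proof.
have E : dH gV gM q l r C =1 by_parity gV1 (fun p x => dH_left x + dH_right x +
    \sum_(i < k) (-1) ^+ (\big[addb/false]_(j < k.+1 | (j < i)%N) p j) *: dH_merge i x).
  apply: eq_by_parity => p x px; congr (_ + _ + _).
  rewrite /shift2 (sgn_homog (px ord0)) linearZl_LR scalerA -expr2 sqrr_sign.
  exact: scale1r.
have FP p : multilinear (fun x => dH_left x + dH_right x +
    \sum_(i < k) (-1) ^+ (\big[addb/false]_(j < k.+1 | (j < i)%N) p j) *: dH_merge i x).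
  apply: multilinearD.
    by apply: multilinearD; [exact: multilinear_dH_left|exact: multilinear_dH_right].
  by apply: multilinear_sum => i; apply/multilinearZ/multilinear_dH_merge.
apply: (eq_homog (g := gV1)) => [||p x px].
- by apply: eq_multilinear (multilinear_by_parity gV1 FP) => x; rewrite E.
- apply: multilinearD.
    by apply: multilinearD; [exact: multilinear_dH_left|exact: multilinear_dH_right].
  by apply: multilinear_sum => i; apply: multilinear_dH_inner.
rewrite E (by_parity_multilinear FP px); congr (_ + _).
by apply: eq_bigr => i _; rewrite (dH_inner_homog _ px).
Qed.

Lemma multilinear_dH : multilinear (dH gV gM q l r C).
Proof.
apply: eq_multilinear (fsym dHE) _; apply: multilinearD.
  by apply: multilinearD; [exact: multilinear_dH_left|exact: multilinear_dH_right].
by apply: multilinear_sum => i; apply: multilinear_dH_inner.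
Qed.

Lemma dH_left_parity : has_parity gV gM false dH_left.
Proof.
move=> p x px; have := Codd (phomog_tail px); have := px ord0.
rewrite tot_recl !par_gshift addbT negbK addbF => x0 Cx.
rewrite /dH_left -[~~ _]addNb.
exact: (degree0_par l0).
Qed.

Lemma dH_right_parity : has_parity gV gM false dH_right.
Proof.
move=> p x px; have := Codd (phomog_init px); have := px ord_max.
rewrite tot_recr !par_gshift addbT negbK addbF => x0 Cx.
rewrite -addbN /dH_right /shift2.
apply: (degree0_par r0) => //.
by rewrite sgn_gshift linearN /= par_sgn Cx (sgn_homog Cx).
Qed.

Lemma shift2q_par b c x y : par gV1 b x = x -> par gV1 c y = y ->
  par gV1 (~~ (b (+) c)) (shift2 gV1 q x y) = shift2 gV1 q x y.
Proof.
have -> : b (+) c = ~~ b (+) ~~ c by case: b; case: c.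
rewrite !par_gshift negbK => us vt.
apply: (degree0_par q0) => //.
by rewrite sgn_gshift linearN /= par_sgn us (sgn_homog us).
Qed.

Lemma dH_merge_parity i : has_parity gV gM false (dH_merge i).
Proof.
move=> p x px; have := Codd (phomog_merge i shift2q_par px).
by rewrite tot_merge addbT negbK addbF.
Qed.

Lemma dH_inner_parity i : has_parity gV gM false (dH_inner i).
Proof.
by move=> p x px; rewrite (dH_inner_homog _ px) linearZ /= dH_merge_parity.
Qed.

End Coboundary.
End Cochains.

Lemma lformZ (K : fieldType) (U : vectType K) (f : 'Hom(U, K^o)) a x :
  f (a *: x) = a * f x.
Proof. by rewrite linearZ. Qed.

(** * Rotations on arguments of odd and of even total parity *)

Section Rotations.

Lemma tot_perm n (s : 'S_n) (p : {ffun 'I_n -> bool}) :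
  tot [ffun i => p (s i)] = tot p.
Proof.
by rewrite -[RHS](reindex_koszul s predT); apply: eq_bigr => i _; rewrite ffunE.
Qed.

(** Separating the cases without and with wrap-around replaces modular by linear arithmetic. *)
Lemma cycle_permX_eq n m (i j : 'I_n) :
  (i + m = j)%N \/ (i + m = j + n)%N -> (cycle_perm n ^+ m)%g i = j.
Proof.
by move=> ij; apply/val_inj; rewrite /= cycle_permX; case: ij => ->;
  rewrite ?modnDr modn_small.
Qed.

Variables (K : fieldType) (U : vectType K) (g : grading U).

Lemma perm_form_odd n m (Om : (U ^ n)%type -> K^o) p u :
  multilinear Om -> (forall p v, phomog g p v -> ~~ tot p -> Om v = 0) ->
  (m <= n)%N -> phomog g p u ->
  perm_form g (cycle_perm n ^+ m)%g Om u = Om [ffun i => u ((cycle_perm n ^+ m)%g i)].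
Proof.
move=> OmP Om0 mn pu; rewrite (perm_form_homog _ OmP pu) koszul_cycle_permX //.
case: (boolP (tot p)) => tp; first by rewrite andbF mul1r.
by rewrite (Om0 _ _ (phomog_perm _ pu)) ?mulr0 ?tot_perm.
Qed.

Lemma perm_form_even n m (Om : (U ^ n)%type -> K^o) p u :
  multilinear Om -> ~~ tot p -> (m <= n)%N -> phomog g p u ->
  perm_form g (cycle_perm n ^+ m)%g Om u =
  (-1) ^+ (\big[addb/false]_(i < n | (i < m)%N) p i) *
  Om [ffun i => u ((cycle_perm n ^+ m)%g i)].
Proof.
move=> OmP tp mn pu; rewrite (perm_form_homog _ OmP pu) koszul_cycle_permX //.
by rewrite tp andbT.
Qed.

End Rotations.

(** * Matching the rotations of the contracted form with the coboundary terms *)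

Section Contraction.
Variables (K : fieldType) (V M : vectType K) (gV : grading V) (gM : grading M).
Variables (q : {bilinear V -> V -> V}) (l : {bilinear V -> M -> M})
          (r : {bilinear M -> V -> M}).
Hypotheses (q0 : degree0 gV gV gV q) (l0 : degree0 gV gM gM l)
           (r0 : degree0 gM gV gM r).
Variables (k : nat) (C : (V ^ k)%type -> M).
Hypotheses (CP : multilinear C) (Codd : has_parity gV gM true C).
Local Notation Vt := (Vt V M).
Local Notation gV1 := (gV1 gV).
Local Notation gM1 := (gM1 gM).
Local Notation gVt1 := (gVt1 gV gM).
Local Notation Omega := (Omega gV gM).
Local Notation Q := (shift2 gVt1 (qt gV gM q l r)).
Local Notation rot n m u := [ffun i => u ((cycle_perm n ^+ m)%g i)].

Definition contracted (u : (Vt ^ k.+2)%type) : (Vt ^ k.+1)%type :=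
  ff_snoc [ffun j => (u : (Vt ^ (2 + k))%type) (rshift 2 j)]
          (Q (u ord0) (u (lift ord0 ord0))).

Definition contracted_parity (p : {ffun 'I_k.+2 -> bool}) : {ffun 'I_k.+1 -> bool} :=
  ff_snoc [ffun j => (p : {ffun 'I_(2 + k) -> bool}) (rshift 2 j)]
          (~~ (p ord0 (+) p (lift ord0 ord0))).

Lemma phomog_contracted p u :
  phomog gVt1 p u -> phomog gVt1 (contracted_parity p) (contracted u).
Proof.
move=> pu i; rewrite !ffunE; case: unliftP => [j|] _; first by rewrite !ffunE pu.
exact: shift2_qt_par.
Qed.

Lemma tot_contracted p : tot (contracted_parity p) = ~~ tot p.
Proof.
rewrite tot_recr ff_init_snoc ff_snoc_max addbN; congr negb.
rewrite [RHS]/tot !big_ord_recl.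
have <- : tot [ffun j => (p : {ffun 'I_(2 + k) -> bool}) (rshift 2 j)] =
    \big[addb/false]_(i < k) p (lift ord0 (lift ord0 i)).
  by apply: eq_bigr => i _; rewrite ffunE; congr (p _); apply/val_inj.
by rewrite addbC -addbA.
Qed.

(** Rotating by 1 puts u_0 last, to be paired with u_1 acting on C from the left; the rotation sign
    is the [sgn] of u_0 in [shift2_qt_form]. Rotating by 2 puts u_1 last, to be paired with u_0
    acting on C from the right. *)
Lemma contracted_rot0 p u : phomog gVt1 p u -> ~~ tot p ->
  Omega (ext0 C) (contracted u) =
  perm_form gVt1 (cycle_perm k.+2 ^+ 1)%g (Omega (ext0 (dH_left l C))) u +
  perm_form gVt1 (cycle_perm k.+2 ^+ 2)%g (Omega (ext0 (dH_right gM r C))) u.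
Proof.
move=> pu tp.
have OlP := multilinear_Omega_ext0 gV gM (multilinear_dH_left l CP).
have OrP := multilinear_Omega_ext0 gV gM (multilinear_dH_right gM r CP).
rewrite (perm_form_even OlP tp _ pu) // (perm_form_even OrP tp _ pu) //.
rewrite !Omega_ext0E /contracted ff_init_snoc ff_snoc_max (shift2_qt_form q0 l0 r0).
set w := [ffun j => _] : (Vt ^ k)%type; set a := C (base w); rewrite addrC.
congr (_ + _).
  have -> : dH_left l C (base (ff_init (rot k.+2 1 u))) = l (u (lift ord0 ord0)).1.1 a.
    rewrite /dH_left !ffunE; congr (l (u _).1.1 (C _)).
      by apply: cycle_permX_eq; left.
    apply/ffunP => j; rewrite !ffunE; congr (u _).1.1.
    by apply: cycle_permX_eq; left; rewrite /= /bump; have := ltn_ord j; lia.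
  rewrite ffunE (cycle_permX_eq (j := ord0)); last by right; rewrite /= addn1.
  rewrite (sgn_homog (pu ord0)) big_mkcond big_ord_recl /= big1 // addbF.
  by rewrite scale_lfunE mulrN.
have -> : dH_right gM r C (base (ff_init (rot k.+2 2 u))) =
    r (sgn gM1 a) (u ord0).1.1.
  rewrite /dH_right /shift2 !ffunE; congr (r (sgn gM1 (C _)) (u _).1.1).
    apply/ffunP => j; rewrite !ffunE; congr (u _).1.1.
    by apply: cycle_permX_eq; left; rewrite /= /bump; have := ltn_ord j; lia.
  by apply: cycle_permX_eq; right; rewrite /= /bump; lia.
rewrite ffunE (cycle_permX_eq (j := lift ord0 ord0)); last by right; rewrite /= /bump; lia.
rewrite big_mkcond !big_ord_recl /= big1 // addbF.
have pw : phomog gVt1 [ffun j => (p : {ffun 'I_(2 + k) -> bool}) (rshift 2 j)] w.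
  by move=> j; rewrite !ffunE pu.
rewrite (sgn_homog (Codd (phomog_base pw))) -/a.
(* As the total is even, u_2, .., u_(k+1) have the joint parity of u_0, u_1. The sign of the odd C
   in [shift2] is thus opposite to the rotation sign, and the minus of [Omega_ext0E] compensates. *)
have -> : tot [ffun j => (p : {ffun 'I_(2 + k) -> bool}) (rshift 2 j)] (+) true =
    ~~ (p ord0 (+) p (lift ord0 ord0)).
  move: (tot_contracted p); rewrite tot_recr ff_init_snoc ff_snoc_max tp.
  by case: (tot _); case: (p _ (+) p _).
rewrite linearZl_LR lformZ signrN mulNr opprK.
exact: esym (signrMK _ _).
Qed.

Lemma base_sgn (v : Vt) : (sgn gVt1 v).1.1 = sgn gV1 v.1.1.
Proof. by rewrite sgn_gVt1 sgn_gshift sgn_gprod. Qed.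

(** Rotating the k + 1 contracted letters by i + 1 moves the product from slot k to slot k - i - 1 =
    [rev_ord i]. Rotating the k + 2 original letters by i + 3 puts u_0, u_1 in this slot and the
    next, and leaves u_(i+2) last on both sides. For i = k - 1 the latter rotation is the
    identity. *)
Lemma contracted_rot (i : 'I_k) p u : phomog gVt1 p u -> ~~ tot p ->
  Omega (ext0 C) (rot k.+1 i.+1 (contracted u)) =
  perm_form gVt1 (cycle_perm k.+2 ^+ i.+3)%g
    (Omega (ext0 (dH_inner gV q C (rev_ord i)))) u.
Proof.
move=> pu tp; set j := rev_ord i.
have jE : j = (k - i.+1)%N :> nat by [].
have OP := multilinear_Omega_ext0 gV gM (multilinear_dH_inner gV q CP j).
rewrite (perm_form_even OP tp _ pu); last by have := ltn_ord i; lia.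
set s := (cycle_perm k.+2 ^+ i.+3)%g; rewrite !Omega_ext0E.
have pv : phomog gV1 (ff_init [ffun t => p (s t)])
    (base (ff_init [ffun t => u (s t)])).
  exact/phomog_base/phomog_init/phomog_perm.
rewrite (dH_inner_homog _ CP _ pv).
(* The j letters before the product are u_(i+3), .., u_(k+1), the complement of the first i + 3.
   With even total the two blocks have the same parity, so the sign in [dH_inner] cancels the
   rotation sign. *)
have -> : \big[addb/false]_(t < k.+1 | (t < j)%N) ff_init [ffun t => p (s t)] t =
    \big[addb/false]_(t < k.+2 | (t < i.+3)%N) p t.
  transitivity (\big[addb/false]_(t < k.+2 | (t < j)%N) p (s t)).
    rewrite [RHS]big_mkcond big_ord_recr /= (_ : (_ < _)%N = false) ?addbF; last first.
      by lia.
    rewrite -big_mkcond; apply: eq_bigr => t _; rewrite !ffunE; congr (p (s _)).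
    by apply/val_inj; rewrite /= /bump leqNgt ltn_ord.
  transitivity (\big[addb/false]_(t < k.+2 | ~~ (s t < i.+3)%N) p (s t)).
    apply: eq_bigl => t; have := ltn_ord t; have := ltn_ord i.
    rewrite /s cycle_permX jE => ik tk; case: (ltnP (t + i.+3) k.+2) => ti.
      by rewrite modn_small //; lia.
    have -> : (t + i.+3 = (t + i.+3 - k.+2) + k.+2)%N by lia.
    by rewrite modnDr modn_small; lia.
  rewrite (reindex_koszul s (fun t => ~~ (t < i.+3)%N)).
  move: tp; rewrite /tot (bigID (fun t : 'I_k.+2 => (t < i.+3)%N)) /=.
  by do 2!case: (\big[_/_]_(_ | _) _).
have -> : base (ff_init (rot k.+1 i.+1 (contracted u))) =
    ff_merge (shift2 gV1 q) j (base (ff_init [ffun t => u (s t)])).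
  apply/ffunP => t; rewrite !ffunE; have := ltn_ord t; have := ltn_ord i => ik tk.
  case: ltngtP => [tj|tj|/val_inj tj].
  - have tk' : (t + i.+1 < k)%N by rewrite jE in tj; lia.
    rewrite (cycle_permX_eq (j := lift ord_max (Ordinal tk'))); last first.
      by left; rewrite /= /bump; lia.
    rewrite liftK ffunE; congr (u _).1.1; apply/esym/cycle_permX_eq; left.
    by rewrite /= /bump; lia.
  - rewrite -(inj_eq val_inj) (gtn_eqF tj).
    have tk' : (t + i.+1 - k.+1 < k)%N by lia.
    rewrite (cycle_permX_eq (j := lift ord_max (Ordinal tk'))); last first.
      by right; rewrite /= /bump; rewrite jE in tj; lia.
    rewrite liftK ffunE; congr (u _).1.1; apply/esym/cycle_permX_eq; right.
    by rewrite /= /bump; rewrite jE in tj; lia.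
  rewrite tj eqxx (cycle_permX_eq (j := ord_max)); last first.
    by left; rewrite /= /bump; lia.
  rewrite unlift_none.
  have -> : s (lift ord_max (lift ord_max j)) = ord0.
    by apply: cycle_permX_eq; right; rewrite /= /bump; lia.
  have -> : s (lift ord_max (lift ord0 j)) = lift ord0 ord0.
    by apply: cycle_permX_eq; right; rewrite /= /bump; lia.
  exact: (congr1 (fun x => q x _) (base_sgn _)).
have uE : contracted u ((cycle_perm k.+1 ^+ i.+1)%g ord_max) = u (s ord_max).
  have ik := ltn_ord i; rewrite (cycle_permX_eq (j := lift ord_max i)); last first.
    by right; rewrite /= /bump leqNgt ik; lia.
  rewrite ffunE liftK ffunE; congr (u _); apply/esym/cycle_permX_eq; right.
  by rewrite /= /bump; lia.
rewrite lformZ [in LHS]ffunE uE [in RHS]ffunE mulrN; congr (- _); exact: esym (signrMK _ _).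
Qed.

Lemma contracted_sum p u : phomog gVt1 p u ->
  Omega (tilde gV gM C) (contracted u) =
  perm_form gVt1 (cycle_perm k.+2 ^+ 1)%g (Omega (ext0 (dH_left l C))) u +
  perm_form gVt1 (cycle_perm k.+2 ^+ 2)%g (Omega (ext0 (dH_right gM r C))) u +
  \sum_(i < k) perm_form gVt1 (cycle_perm k.+2 ^+ (rev_ord i).+3)%g
    (Omega (ext0 (dH_inner gV q C i))) u.
Proof.
move=> pu; have OP := multilinear_Omega_ext0 gV gM CP.
have pw := phomog_contracted pu.
rewrite (Omega_tilde gV gM CP) cycl_sum.
have rotC m : (m <= k.+1)%N -> perm_form gVt1 (cycle_perm k.+1 ^+ m)%g
    (Omega (ext0 C)) (contracted u) = Omega (ext0 C) (rot k.+1 m (contracted u)).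
  move=> mk; apply: perm_form_odd OP _ mk pw => p' v pv /negPf tv.
  by apply: (Omega_ext0_eq0 Codd pv); rewrite tv.
case: (boolP (tot p)) => tp; last first.
  rewrite -(contracted_rot0 pu tp).
  rewrite big_ord_recl; apply: congr2.
    apply: etrans (rotC 0%N isT) _.
    apply: (congr1 (Omega (ext0 C))).
    by apply/ffunP => t; rewrite ffunE expg0 perm1.
  rewrite [RHS](reindex_inj rev_ord_inj); apply: eq_bigr => i _.
  rewrite rev_ordK -(contracted_rot _ pu tp).
  by apply: (rotC (lift ord0 i)); have := ltn_ord i; rewrite /= /bump; lia.
(* With odd total both sides vanish: the coboundary pieces are even, and the contracted tuple has
   even total while C is odd. *)
have z n (D : (V ^ k.+1)%type -> M) : multilinear D -> has_parity gV gM false D ->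
    perm_form gVt1 (cycle_perm k.+2 ^+ n)%g (Omega (ext0 D)) u = 0.
  move=> DP D0; rewrite (perm_form_homog _ (multilinear_Omega_ext0 gV gM DP) pu).
  by rewrite (Omega_ext0_eq0 D0 (phomog_perm _ pu)) ?mulr0 // tot_perm tp.
rewrite z ?z; do ?[exact: multilinear_dH_left|exact: multilinear_dH_right
  |exact: dH_left_parity|exact: dH_right_parity].
rewrite addr0 add0r !big1 // => i _.
  by apply: z; [exact: multilinear_dH_inner|exact: dH_inner_parity].
rewrite rotC ?(ltnW (ltn_ord _)) //.
by rewrite (Omega_ext0_eq0 Codd (phomog_perm _ pw)) // tot_perm tot_contracted tp.
Qed.

End Contraction.

Section CyclAdditive.
Variables (K : fieldType) (U : vectType K) (g : grading U).

Lemma cyclD n (f h : (U ^ n)%type -> K^o) u :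
  cycl g (fun v => f v + h v) u = cycl g f u + cycl g h u.
Proof.
rewrite /cycl -big_split; apply: eq_bigr => s _ /=.
rewrite /perm_form /by_parity -big_split; apply: eq_bigr => p _ /=.
exact: mulrDr.
Qed.

Lemma cycl_bigsum n (I : Type) (t : seq I) (f : I -> (U ^ n)%type -> K^o) u :
  cycl g (fun v => \sum_(i <- t) f i v) u = \sum_(i <- t) cycl g (f i) u.
Proof.
rewrite /cycl [RHS]exchange_big; apply: eq_bigr => s _ /=.
exact: perm_form_sum.
Qed.

End CyclAdditive.

(** * The Pinczon bracket with the product and the differential of quadratic maps *)

Section PinczonBracket.
Variables (K : fieldType) (V M : vectType K) (gV : grading V) (gM : grading M).
Variables (q : {bilinear V -> V -> V}) (l : {bilinear V -> M -> M})
          (r : {bilinear M -> V -> M}).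
Hypotheses (q0 : degree0 gV gV gV q) (l0 : degree0 gV gM gM l)
           (r0 : degree0 gM gV gM r).
Variables (N : nat) (e e' : N.-tuple (Vt V M)).
Hypotheses (basis_e : basis_of fullv e)
  (dual_e : forall i j : 'I_N, bt gV gM e`_i e'`_j = (i == j)%:R).
Local Notation gVt1 := (gVt1 gV gM).
Local Notation Omega := (Omega gV gM).

Lemma Omega_tilde_eq0 k (C : (V ^ k)%type -> M) p v :
  multilinear C -> has_parity gV gM true C ->
  phomog gVt1 p v -> ~~ tot p -> Omega (tilde gV gM C) v = 0.
Proof.
move=> CP Codd pv /negPf tp; have OP := multilinear_Omega_ext0 gV gM CP.
rewrite (Omega_tilde gV gM CP); apply: big1 => s _.
rewrite (perm_form_homog _ OP pv) (Omega_ext0_eq0 Codd (phomog_perm _ pv)) ?mulr0 //.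
by rewrite tot_perm tp.
Qed.

Lemma pinczon_tilde k (C : (V ^ k)%type -> M) (u : (Vt V M ^ k.+2)%type) :
  multilinear C -> has_parity gV gM true C ->
  pinczon gV gM e e' (Omega (Qt gV gM q l r)) (Omega (tilde gV gM C)) u =
  Omega (tilde gV gM (dH gV gM q l r C)) u.
Proof.
move=> CP Codd; have dP := multilinear_dH gV gM q l r CP.
rewrite (Omega_tilde gV gM dP).
pose O D : (Vt V M ^ k.+2)%type -> K^o := Omega (ext0 (D : (V ^ k.+1)%type -> M)).
have -> : cycl gVt1 (Omega (ext0 (dH gV gM q l r C))) u =
    cycl gVt1 (fun v => O (dH_left l C) v + O (dH_right gM r C) v +
      \sum_(i < k) O (dH_inner gV q C i) v) u.
  apply: eq_cycl => p v _; pose h x : K^o := - (v ord_max).2.2 x.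
  have hD : {morph h : x y / x + y}.
    by move=> x y; rewrite /h linearD; exact: opprD.
  have h0 : h 0 = 0 by rewrite /h linear0; exact: oppr0.
  rewrite Omega_ext0E (dHE _ _ _ _ _ CP) -/(h _) !hD (big_morph h hD h0) /O.
  rewrite !Omega_ext0E; congr (_ + _); apply: eq_bigr => i _.
  by rewrite Omega_ext0E.
pose c := cycle_perm k.+2.
have cP m : (c ^+ m)%g \in <[c]>%g by apply: mem_cycle.
have -> : pinczon gV gM e e' (Omega (Qt gV gM q l r)) (Omega (tilde gV gM C)) u =
    cycl gVt1 (fun v => perm_form gVt1 (c ^+ 1)%g (O (dH_left l C)) v +
      perm_form gVt1 (c ^+ 2)%g (O (dH_right gM r C)) v +
      \sum_(i < k) perm_form gVt1 (c ^+ (rev_ord i).+3)%g (O (dH_inner gV q C i)) v) u.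
  apply: eq_cycl => p v pv.
  rewrite -(contracted_sum q0 l0 r0 CP Codd pv).
  apply: (contraction_homog basis_e dual_e _ _ _ _ _ pv).
  - exact: shift2_qt_par.
  - by move=> w; apply: qt0r.
  - by move=> w; rewrite /shift2 linear0; apply: qt0l.
  - exact: (quadratic_tilde gV gM CP).1.
  by move=> p' w; apply: Omega_tilde_eq0.
have OP D : multilinear D -> multilinear (O D) by apply: multilinear_Omega_ext0.
have cyclE f1 f2 (f3 : 'I_k -> (Vt V M ^ k.+2)%type -> K^o) :
    cycl gVt1 (fun v => f1 v + f2 v + \sum_(i < k) f3 i v) u =
    cycl gVt1 f1 u + cycl gVt1 f2 u + \sum_(i < k) cycl gVt1 (f3 i) u.
  apply: etrans (cyclD gVt1 _ _ _) _.
  exact: congr2 (cyclD gVt1 _ _ _) (cycl_bigsum gVt1 _ _ _).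
apply: etrans (cyclE _ _ _) (etrans _ (esym (cyclE _ _ _))).
apply: congr2; last apply: eq_bigr => i _; first apply: congr2.
- by apply: (cycl_perm_form gVt1 _ (cP 1%N)); apply/OP/multilinear_dH_left.
- by apply: (cycl_perm_form gVt1 _ (cP 2)); apply/OP/multilinear_dH_right.
by apply: (cycl_perm_form gVt1 _ (cP (rev_ord i).+3)); apply/OP/multilinear_dH_inner.
Qed.

Lemma dP_tilde k (C : (V ^ k)%type -> M) (u : (Vt V M ^ k.+1)%type) :
  multilinear C -> has_parity gV gM true C ->
  dP gV gM q l r e e' (tilde gV gM C) u = tilde gV gM (dH gV gM q l r C) u.
Proof.
move=> CP Codd; have dP := multilinear_dH gV gM q l r CP.
have [tP _] := quadratic_tilde gV gM dP.
have OP := multilinear_cycl_ext0 gV gM dP.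
apply: eq_map_of_form => [|v]; last first.
  rewrite (Bt_tilde gV gM u v dP) -(Omega_tilde gV gM dP).
  exact/esym/pinczon_tilde.
(* Multilinearity of the bracket is inherited from the form it was shown to equal, rather than
   proved on the contraction. *)
apply: eq_multilinear OP => v; rewrite -(Omega_tilde gV gM dP).
exact/esym/pinczon_tilde.
Qed.

End PinczonBracket.

Theorem proposition4p4 (K : fieldType) (charK0 : [pchar K] =i pred0)
  (V M : vectType K) (gV : grading V) (gM : grading M)
  (q : {bilinear V -> V -> V}) (l : {bilinear V -> M -> M})
  (r : {bilinear M -> V -> M})
  (algV : graded_algebra gV q) (bimodM : graded_bimodule gV gM q l r)
  (N : nat) (e e' : N.-tuple (Vt V M))
  (basis_e : basis_of fullv e)
  (dual_e : forall i j : 'I_N, bt gV gM e`_i e'`_j = (i == j)%:R) :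
  (forall (k : nat) (a : K) (c c' : (V ^ k)%type -> M),
     cochain gV gM c -> cochain gV gM c' ->
     forall u, Phi gV gM (fun x => a *: c x + c' x) u =
               a *: Phi gV gM c u + Phi gV gM c' u) /\
  (forall (k : nat) (c : (V ^ k)%type -> M), cochain gV gM c ->
     let C := shiftmap (gV1 gV) c in
     let Ct := Phi gV gM c in
     let dC := dH gV gM q l r C in
     [/\ quadratic gV gM Ct,
         forall u, dP gV gM q l r e e' Ct u = tilde gV gM dC u
       & forall u : (Vt V M ^ k.+2)%type,
           pinczon gV gM e e' (Omega gV gM (Qt gV gM q l r)) (Omega gV gM Ct) u
           = Omega gV gM (tilde gV gM dC) u]).
Proof.
have [_ q0] := algV; have [l0 r0 _ _ _] := bimodM; split.
  move=> k a c c' [cP _] [c'P _].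
  apply: tilde_linear; do ?exact: multilinear_shiftmap.
  move=> x; rewrite /shiftmap /by_parity scaler_sumr -big_split /=.
  apply: eq_bigr => p _; by rewrite scalerDr !scalerA mulrC.
move=> k c cc C Ct dC.
have CP : multilinear C by apply: multilinear_shiftmap; case: cc.
have Codd : has_parity gV gM true C.
  by apply: shiftmap_parity (cochain_parity cc); case: cc.
split=> [|u|u].
- exact: quadratic_tilde.
- exact: dP_tilde.
exact: pinczon_tilde.
Qed.
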